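(* Let $\mu>0$ and $1<\lambda\le 2$, and let $k$ be the symmetric stable density with characteristic function $\phi_k(t)=e^{-|t|^\lambda/\mu}$. Let $X_j=Y_j+Z_j$, $j=1,2,\dots$, be i.i.d. real random variables, where for each $j$ the variables $Y_j$ and $Z_j$ are independent, $Y_j$ has a probability density $f$ on $\mathbb{R}$ and $Z_j$ has density $k$. Let $f_{nh}$ be the kernel type deconvolution density estimator based on $X_1,\dots,X_n$ with the sinc kernel $w(x)=\sin x/(\pi x)$ and bandwidth $h=h_n>0$, and let $x\in\mathbb{R}$. Then, as $n\to\infty$ and $h\to 0$, $$ \frac{\sqrt{n}}{h^{\lambda-1}\,e^{\frac{1}{\mu h^\lambda}}}\,\bigl(f_{nh}(x)-\mathrm{E}\, f_{nh}(x)\bigr)\ \xrightarrow{\ \mathcal{D}\ }\ N\Bigl(0,\ \frac{1}{2\pi^2}\,(\mu/\lambda)^2\Bigr). $$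
   Context: The bandwidth $h=h_n$ is a deterministic sequence of positive numbers. The kernel type deconvolution estimator of $f(x)$ with kernel $w$ and bandwidth $h$ is $$ f_{nh}(x)=\frac{1}{2\pi}\int_{-\infty}^{\infty} e^{-itx}\,\frac{\phi_w(ht)\,\phi_{emp}(t)}{\phi_k(t)}\,dt,\qquad \phi_{emp}(t)=\frac1n\sum_{j=1}^n e^{itX_j}, $$ where $\phi_w$ and $\phi_k$ are the characteristic functions (Fourier transforms $\int e^{itx}(\cdot)\,dx$) of $w$ and $k$. For the sinc kernel $w(x)=\sin x/(\pi x)$ one takes $\phi_w(t)=I_{[-1,1]}(t)$. $\xrightarrow{\mathcal{D}}$ denotes convergence in distribution and $N(0,\sigma^2)$ the normal distribution with mean $0$ and variance $\sigma^2$. *)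

(* Defs.v *)
From HB Require Import structures.
From mathcomp Require Import all_boot all_order all_algebra.
From mathcomp Require Import finmap complex.
From mathcomp Require Import all_classical all_reals all_analysis.
From mathcomp Require Import measurable_realfun ring.

Set Implicit Arguments.
Unset Strict Implicit.
Unset Printing Implicit Defensive.

Import Order.TTheory GRing.Theory Num.Theory.
Import numFieldNormedType.Exports.

Local Open Scope classical_set_scope.
Local Open Scope ring_scope.
Local Open Scope complex_scope.

Definition expi {R : realType} (theta : R) : R[i] := cos theta +i* sin theta.

(* The Lebesgue integral of a complex-valued function, by components; it is
   meaningful only when both components are integrable. *)
Definition cintegral {R : realType} (g : R -> R[i]) : R[i] :=
  (\int[lebesgue_measure]_t complex.Re (g t)) +i*
  (\int[lebesgue_measure]_t complex.Im (g t)).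

Definition fourier {R : realType} (g : R -> R) (t : R) : R[i] :=
  cintegral (fun x => expi (t * x) * (g x)%:C).

(* The sinc kernel w(x) = sin x / (pi x) is square integrable but not
   absolutely integrable, so that [fourier w] is not the right object for it:
   its Fourier transform is the indicator of [-1, 1]. *)
Definition phi_sinc {R : realType} (t : R) : R[i] := (\1_`[-1, 1] t : R)%:C.

Definition is_density {R : realType} (g : R -> R) : Prop :=
  [/\ measurable_fun [set: R] g, forall x, 0 <= g x &
      (\int[lebesgue_measure]_x (g x)%:E = 1)%E].

Definition has_density d (T : measurableType d) (R : realType)
    (P : probability T R) (V : {RV P >-> R}) (g : R -> R) : Prop :=
  is_density g /\ forall A : set R, measurable A ->
    distribution P V A = (\int[lebesgue_measure]_(x in A) (g x)%:E)%E.

Definition independent2 d (T : measurableType d) (R : realType)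
    (P : probability T R) (U V : T -> R) : Prop :=
  forall A B : set R, measurable A -> measurable B ->
    P ((U @^-1` A) `&` (V @^-1` B)) = (P (U @^-1` A) * P (V @^-1` B))%E.

Definition mutually_independent d (T : measurableType d) (R : realType)
    (P : probability T R) (X : nat -> T -> R) : Prop :=
  forall (J : {fset nat}) (A : nat -> set R), (forall j, measurable (A j)) ->
    P (\bigcap_(j in [set` J]) (X j @^-1` A j)) =
    (\prod_(j <- J) P (X j @^-1` A j))%E.

Definition identically_distributed d (T : measurableType d) (R : realType)
    (P : probability T R) (X : nat -> T -> R) : Prop :=
  forall (i j : nat) (A : set R), measurable A ->
    P (X i @^-1` A) = P (X j @^-1` A).

Definition iid d (T : measurableType d) (R : realType)
    (P : probability T R) (X : nat -> T -> R) : Prop :=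
  [/\ forall j, measurable_fun [set: T] (X j), mutually_independent P X
    & identically_distributed P X].

Definition cvg_in_distribution d (T : measurableType d) (R : realType)
    (P : probability T R) (W : nat -> T -> R)
    (Q : probability (measurableTypeR R) R) : Prop :=
  (forall n, measurable_fun [set: T] (W n)) /\
  forall a : R, {for a, continuous (fun b : R => Q `]-oo, b]%classic)} ->
    P (W n @^-1` `]-oo, a]%classic) @[n --> \oo] --> Q `]-oo, a]%classic.

(* The sample X_1, ..., X_n is X 0, ..., X n.-1. *)
Definition phi_emp {T : Type} {R : realType} (X : nat -> T -> R) (n : nat)
    (omega : T) (t : R) : R[i] :=
  n%:R^-1 * \sum_(j < n) expi (t * X j omega).

Definition deconv_integral {T : Type} {R : realType} (phi_w phi_k : R -> R[i])
    (X : nat -> T -> R) (n : nat) (h x : R) (omega : T) : R[i] :=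
  ((2 * pi)^-1)%:C *
  cintegral (fun t =>
    expi (- (t * x)) * (phi_w (h * t) * phi_emp X n omega t / phi_k t)).

(* When phi_w and phi_k are real and even the complex integral is a real
   number (lemma deconv_integral_real below); taking its real part only changes
   its type. *)
Definition deconv_estimator {T : Type} {R : realType} (phi_w phi_k : R -> R[i])
    (X : nat -> T -> R) (n : nat) (h x : R) (omega : T) : R :=
  complex.Re (deconv_integral phi_w phi_k X n h x omega).

Lemma Rintegral_odd {R : realType} (g : R -> R) :
  measurable_fun [set: R] g -> (forall t, g (- t) = - g t) ->
  \int[lebesgue_measure]_t g t = 0.
Proof.
move=> mg gN; rewrite /Rintegral integralE.
set I := (X in (X - _)%E); set J := (X in (_ - X)%E).
suff -> : J = I by case: I => [r| |] //=; rewrite subrr.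
pose G : R -> \bar R := (fun t => (g t)%:E)^\+%E.
have mG : measurable_fun [set: R] G.
  by apply: measurable_funepos; exact/measurable_EFinP.
transitivity (\int[pushforward lebesgue_measure
    (-%R : _ -> measurableTypeR R)]_t G t)%E.
  rewrite ge0_integral_pushforward//=; last by move=> y _; exact: funepos_ge0.
  apply: eq_integral => t _ /=.
  by rewrite /G !funepos.unlock !funeneg.unlock /= gN EFinN.
by apply: eq_measure_integral => A mA _; exact: lebesgue_measureN.
Qed.

Lemma expiD {R : realType} (a b : R) : expi (a + b) = expi a * expi b.
Proof.
by rewrite /expi cosD sinD; apply/eqP; rewrite eq_complex /= eqxx /= addrC.
Qed.

Lemma deconv_integral_real {T : Type} {R : realType} (p q : R -> R)
    (X : nat -> T -> R) (n : nat) (h x : R) (omega : T) :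
  measurable_fun [set: R] p -> measurable_fun [set: R] q ->
  (forall t, p (- t) = p t) -> (forall t, q (- t) = q t) ->
  let phi_w := fun t => (p t)%:C in let phi_k := fun t => (q t)%:C in
  deconv_integral phi_w phi_k X n h x omega =
  (deconv_estimator phi_w phi_k X n h x omega)%:C.
Proof.
move=> mp mq pN qN phi_w phi_k.
rewrite /deconv_estimator /deconv_integral /cintegral.
set A := (X in X +i* _); set B := (X in _ +i* X).
suff -> : B = 0.
  by apply/eqP; rewrite eq_complex /= !mulr0 !mul0r subr0 addr0 !eqxx.
pose s t := p (h * t) / q t / n%:R *
  \sum_(j < n) sin (t * (X j omega - x)).
have ImM (c : R) (z : R[i]) : complex.Im (c%:C * z) = c * complex.Im z.
  by case: z => a b /=; rewrite mul0r addr0.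
have Bs : (fun t => complex.Im (expi (- (t * x)) *
    (phi_w (h * t) * phi_emp X n omega t / phi_k t))) = s.
  apply/funext => t; rewrite /s /phi_emp.
  have -> : expi (- (t * x)) * (phi_w (h * t) *
      (n%:R^-1 * (\sum_(j < n) expi (t * X j omega))) / phi_k t) =
      (p (h * t) / q t / n%:R)%:C *
      \sum_(j < n) expi (t * (X j omega - x)).
    under [in RHS]eq_bigr do rewrite mulrBr addrC expiD.
    rewrite -mulr_sumr /phi_w /phi_k !rmorphM !fmorphV rmorph_nat.
    move: (expi _) (\sum_(_ < _) _) (_^-1) (_^-1) => a b c e.
    by ring.
  by rewrite ImM raddf_sum.
rewrite /B Bs; apply: Rintegral_odd.
- have mph : measurable_fun [set: R] (fun t => p (h * t)).
    by apply: (measurableT_comp mp); exact: measurable_funM.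
  have mV : measurable_fun [set: R] (fun t => (q t)^-1).
    have -> : (fun t => (q t)^-1) = (fun t => q t * (q t ^+ 2) `^ (-1)).
      apply/funext => t; rewrite powR_inv1 ?sqr_ge0// expr2 invfM.
      by have [->|q0] := eqVneq (q t) 0; rewrite ?invr0 ?mul0r// mulVKf.
    apply: measurable_funM => //; apply: (measurableT_comp (measurable_powR _)).
    exact: measurable_funX.
  apply: measurable_funM.
    by apply: measurable_funM => //; exact: (measurable_funM mph mV).
  apply: measurable_sum => j.
  apply: (measurableT_comp (f := sin)); last exact: measurable_funM.
  by apply: continuous_measurable_fun; exact: continuous_sin.
- move=> t; rewrite /s mulrN pN qN -mulrN -sumrN; congr (_ * _).
  by apply: eq_bigr => j _; rewrite mulNr sinN.
Qed.

(* Main.v *)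
(* Bounded independent summands obey the central limit theorem by Lindeberg's
   telescoping along the heat flow u(s, y) = Phi((a - y) / sqrt s): since
   u_s = u_yy / 2, adding one centred summand to y while taking its variance off
   s changes the expectation of u only by third-order terms, so no normal
   variable is ever adjoined to the sample and no characteristic function is
   inverted.

   For the estimator, put A = 1 / h. For lambda > 1 the integral of
   cos(t b) e^(t^lambda / mu) over [0, A] is asymptotic to
   (mu / lambda) A^(1 - lambda) cos(A b) e^(A^lambda / mu): the A-derivative of
   the difference is dominated by that of A^(2 - 2 lambda) e^(A^lambda / mu).
   After normalisation a summand is thus bounded and asymptotic to
   (mu / (pi lambda)) cos((X - x) / h). The characteristic function of X is at
   most e^(-|t|^lambda / mu) in absolute value, so the phase (X - x) / h
   equidistributes: the mean of this cosine tends to 0 and its variance to 1 / 2. *)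

Require Import Defs.
From mathcomp Require Import all_boot all_order all_algebra.
From mathcomp Require Import finmap complex.
From mathcomp Require Import all_classical all_reals all_analysis.
From mathcomp Require Import measurable_realfun ring lra.

Set Implicit Arguments.
Unset Strict Implicit.
Unset Printing Implicit Defensive.

Import Order.TTheory GRing.Theory Num.Theory.
Import numFieldNormedType.Exports.

Local Open Scope classical_set_scope.
Local Open Scope ring_scope.
Local Open Scope complex_scope.

(** * Bounded measurable functions and independence *)

(** The error constant in the asymptotics of the integral grows with |b|, that is, with the distance
    from the observation to x, so the cosine approximation is only pointwise. Boundedness comes from
    elsewhere: |cos| <= 1 dominates every integral by the one at b = 0, and that single asymptotic
    bounds all normalised summands once h is small. Dominated convergence then makes the
    approximation hold in mean, which is all that the mean and the variance require. As the bound is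
    free of h, the total Lindeberg error is of order n^(-1/2) however fast h tends to 0. The
    variance uses cos^2 = (1 + cos 2) / 2, so equidistribution is needed at the doubled frequency as
    well. The heat flow is stopped at a positive time [dlt], because its derivatives blow up as s
    tends to 0. The remaining smoothing is undone by moving the threshold [a] by k sqrt(dlt) either
    way, with k taken from the tails of Phi and [dlt] chosen small before n is taken large. *)

(** Under a probability measure membership in this class already gives integrability, so closure
    under arithmetic and composition settles the integrability conditions on expectations. *)
Definition bounded_mfun d (T : measurableType d) (R : realType) (f : T -> R) :=
  measurable_fun [set: T] f /\ exists M, forall w, `|f w| <= M.

Section bounded_mfun_theory.
Context d (T : measurableType d) (R : realType).
Implicit Types f g : T -> R.

Lemma bounded_mfun_cst (c : R) : bounded_mfun (fun _ : T => c).
Proof. by split; [exact: measurable_cst|exists `|c|]. Qed.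

Lemma bounded_mfunD f g : bounded_mfun f -> bounded_mfun g ->
  bounded_mfun (fun w => f w + g w).
Proof.
move=> [mf [M fM]] [mg [N gN]]; split; first exact: measurable_funD.
by exists (M + N) => w; rewrite (le_trans (ler_normD _ _))// lerD.
Qed.

Lemma bounded_mfunM f g : bounded_mfun f -> bounded_mfun g ->
  bounded_mfun (fun w => f w * g w).
Proof.
move=> [mf [M fM]] [mg [N gN]]; split; first exact: measurable_funM.
by exists (M * N) => w; rewrite normrM ler_pM.
Qed.

Lemma bounded_mfunB f g : bounded_mfun f -> bounded_mfun g ->
  bounded_mfun (fun w => f w - g w).
Proof.
move=> [mf [M fM]] [mg [N gN]]; split; first exact: measurable_funB.
by exists (M + N) => w; rewrite (le_trans (ler_normB _ _))// lerD.
Qed.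

Lemma bounded_mfun_norm f : bounded_mfun f -> bounded_mfun (fun w => `|f w|).
Proof.
move=> [mf [M fM]]; split; first exact: measurableT_comp.
by exists M => w; rewrite normr_id.
Qed.

Lemma bounded_mfun_sum n (f : nat -> T -> R) :
  (forall i, bounded_mfun (f i)) -> bounded_mfun (fun w => \sum_(i < n) f i w).
Proof.
move=> bf; elim: n => [|n IH].
  by under eq_fun do rewrite big_ord0; exact: bounded_mfun_cst.
by under eq_fun do rewrite big_ord_recr/=; exact: bounded_mfunD.
Qed.

Lemma bounded_mfun_indic (A : set T) : measurable A ->
  bounded_mfun (\1_A : T -> R).
Proof.
move=> mA; split; first exact: measurable_indic.
by exists 1 => w; rewrite indicE; case: (_ \in _); rewrite ?normr1 ?normr0.
Qed.

End bounded_mfun_theory.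

Lemma bounded_mfun_comp d d' (T : measurableType d) (T' : measurableType d')
    (R : realType) (U : T -> T') (f : T' -> R) :
  measurable_fun [set: T] U -> bounded_mfun f ->
  bounded_mfun (fun w => f (U w)).
Proof.
move=> mU [mf [M fM]]; split; first exact: measurableT_comp.
by exists M => w.
Qed.

Section bounded_expectation.
Context d (T : measurableType d) (R : realType) (P : probability T R).
Implicit Types f g : T -> R.

Lemma bounded_integrable f :
  bounded_mfun f -> P.-integrable [set: T] (EFin \o f).
Proof.
move=> [mf [M fM]]; apply: measurable_bounded_integrable => //.
  by rewrite (le_lt_trans (probability_le1 _ measurableT))// ltry.
exists M; split; first exact: num_real.
by move=> x Mx y _; rewrite /= (le_trans (fM y))// ltW.
Qed.

Lemma expectation_bounded f : bounded_mfun f ->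
  ('E_P[f] = (\int[P]_w f w)%R%:E)%E.
Proof.
move=> bf; rewrite unlock /Rintegral fineK//.
by apply: integrable_fin_num => //; exact: bounded_integrable.
Qed.

Lemma Rintegral_prob_cst (c : R) : \int[P]_w c = c.
Proof. by rewrite Rintegral_cst//= [X in fine X](probability_setT P) mulr1. Qed.

Lemma Rintegral_boundedD f g : bounded_mfun f -> bounded_mfun g ->
  \int[P]_w (f w + g w) = \int[P]_w f w + \int[P]_w g w.
Proof. by move=> bf bg; apply: RintegralD => //; exact: bounded_integrable. Qed.

Lemma Rintegral_boundedB f g : bounded_mfun f -> bounded_mfun g ->
  \int[P]_w (f w - g w) = \int[P]_w f w - \int[P]_w g w.
Proof. by move=> bf bg; apply: RintegralB => //; exact: bounded_integrable. Qed.

Lemma Rintegral_boundedZl (c : R) f : bounded_mfun f ->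
  \int[P]_w (c * f w) = c * \int[P]_w f w.
Proof. by move=> bf; apply: RintegralZl => //; exact: bounded_integrable. Qed.

Lemma le_Rintegral_bounded f g : bounded_mfun f -> bounded_mfun g ->
  (forall w, f w <= g w) -> \int[P]_w f w <= \int[P]_w g w.
Proof.
by move=> bf bg fg; apply: le_Rintegral => //; exact: bounded_integrable.
Qed.

Lemma le_norm_Rintegral_bounded f : bounded_mfun f ->
  `|\int[P]_w f w| <= \int[P]_w `|f w|.
Proof. by move=> bf; apply: le_normr_Rintegral => //; exact: bounded_integrable. Qed.

Lemma norm_Rintegral_le f (M : R) : bounded_mfun f ->
  (forall w, `|f w| <= M) -> `|\int[P]_w f w| <= M.
Proof.
move=> bf fM; apply: (le_trans (le_norm_Rintegral_bounded bf)).
rewrite -[leRHS]Rintegral_prob_cst; apply: le_Rintegral_bounded => //.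
  exact: bounded_mfun_norm.
exact: bounded_mfun_cst.
Qed.

Lemma Rintegral_indic (A : set T) : measurable A ->
  \int[P]_w (\1_A w : R) = fine (P A).
Proof. by move=> mA; rewrite /Rintegral integral_indic// setIT. Qed.

(** The bound is assumed only eventually, since the normalised summands are uniformly bounded only
    once [h] is small; the sequence is shifted past that rank. *)
Lemma bounded_dominated_cvg (f : nat -> T -> R) (M : R) :
  (forall n, measurable_fun [set: T] (f n)) ->
  (\forall n \near \oo, forall w, `|f n w| <= M) ->
  (forall w, f n w @[n --> \oo] --> (0 : R)) ->
  \int[P]_w f n w @[n --> \oo] --> (0 : R).
Proof.
move=> mf [N _ fM] f0; rewrite -(cvg_shiftn N).
suff : (\int[P]_w (f (n + N)%N w)%:E)%E @[n --> \oo] --> (0 : R)%:E.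
  by move/fine_cvg.
rewrite -[X in _ --> X](@integral0_eq _ _ _ P setT (fun=> 0%E))//.
apply: (@dominated_cvg _ _ _ P setT measurableT
  (fun n w => (f (n + N)%N w)%:E) (fun=> 0%E) (fun=> M%:E)) => //.
- by move=> n; apply/measurable_EFinP.
- move=> w _; apply: cvg_EFin; first by near=> n.
  by have := f0 w; rewrite -(cvg_shiftn N).
- exact: (bounded_integrable (bounded_mfun_cst _ M)).
- by move=> n w _; rewrite /= lee_fin; apply: fM; rewrite /= leq_addl.
Unshelve. all: by end_near. Qed.

End bounded_expectation.

(** * Independence, partial sums and densities *)

Section independence.
Context d (T : measurableType d) (R : realType) (P : probability T R).

(** Independence says that the law of [(U, V)] and the product of the two laws agree on rectangles,
    hence everywhere; Fubini then splits the integral. *)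
Lemma independent2_Rintegral (U V : T -> R) (f g : R -> R) :
  measurable_fun [set: T] U -> measurable_fun [set: T] V ->
  independent2 P U V -> bounded_mfun f -> bounded_mfun g ->
  \int[P]_w (f (U w) * g (V w)) = \int[P]_w f (U w) * \int[P]_w g (V w).
Proof.
move=> mU mV UV bf bg.
pose UV2 : T -> (R * R)%type := fun w => (U w, V w).
have mUV : measurable_fun [set: T] UV2 by exact: measurable_fun_pair.
pose PU := distribution P (mfun_Sub (mem_set mU)).
pose PV := distribution P (mfun_Sub (mem_set mV)).
pose PUV := distribution P (mfun_Sub (mem_set mUV)).
have PUVE X : measurable X -> (PU \x PV)%E X = PUV X.
  by apply: product_measure_unique => A B mA mB; rewrite -UV.
pose h (z : R * R) := f z.1 * g z.2.
have bh : bounded_mfun h.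
  apply: bounded_mfunM; first exact: (bounded_mfun_comp _ bf).
  exact: (bounded_mfun_comp _ bg).
have ih : (PU \x PV)%E.-integrable [set: _] (EFin \o h).
  apply/integrableP; split; first by apply/measurable_EFinP; case: bh.
  rewrite (eq_measure_integral PUV); last by move=> A mA _; exact: PUVE.
  by have /integrableP[] := bounded_integrable PUV bh.
transitivity (\int[PUV]_z h z).
  rewrite /Rintegral integral_pushforward//.
    by apply/measurable_EFinP; case: bh.
  by apply: (bounded_integrable _ (f := h \o UV2)); exact: (bounded_mfun_comp mUV bh).
transitivity (fine (\int[(PU \x PV)%E]_z (h z)%:E)%E).
  congr fine; apply: eq_measure_integral => A mA _.
  by apply/esym; exact: PUVE.
rewrite -integral12_prod_meas1//=.
have dE (W : T -> R) (mW : measurable_fun [set: T] W) (k : R -> R) :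
    bounded_mfun k ->
    \int[P]_w k (W w) = \int[distribution P (mfun_Sub (mem_set mW))]_y k y.
  move=> bk; rewrite /Rintegral integral_pushforward//.
    by apply/measurable_EFinP; case: bk.
  by apply: (bounded_integrable _ (f := k \o W)); exact: (bounded_mfun_comp mW bk).
rewrite (dE U mU f bf) (dE V mV g bg) -/PU -/PV.
rewrite [RHS]mulrC -Rintegral_boundedZl//; congr fine.
apply: eq_integral => y _.
rewrite /fubini_F/=.
rewrite -[LHS]fineK; last first.
  apply: integrable_fin_num => //.
  apply: (bounded_integrable _ (f := fun z => f y * g z)).
  by apply: bounded_mfunM => //; exact: bounded_mfun_cst.
by congr EFin; rewrite [RHS]mulrC -(Rintegral_boundedZl _ _ bg).
Qed.

(* Both sides are finite measures in [D], and rectangles form a pi-system. *)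
Lemma rectangle_independent (U V : T -> R) (C : set T) :
  measurable_fun [set: T] U -> measurable_fun [set: T] V -> measurable C ->
  (forall A B : set R, measurable A -> measurable B ->
    P (U @^-1` A `&` V @^-1` B `&` C) =
    (P (U @^-1` A `&` V @^-1` B) * P C)%E) ->
  forall D : set (R * R), measurable D ->
    P ((fun w => (U w, V w)) @^-1` D `&` C) =
    (P ((fun w => (U w, V w)) @^-1` D) * P C)%E.
Proof.
move=> mU mV mC rect D mD.
pose UV2 : T -> (R * R)%type := fun w => (U w, V w).
have mUV : measurable_fun [set: T] UV2 by exact: measurable_fun_pair.
pose r : {nonneg R} := NngNum (fine_ge0 (measure_ge0 P C)).
pose m1 := pushforward (mrestr P mC) (mfun_Sub (mem_set mUV)).
pose m2 := mscale r (distribution P (mfun_Sub (mem_set mUV))).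
have m2E E : m2 E = (P (UV2 @^-1` E) * P C)%E.
  by rewrite /m2 /mscale/= fineK ?fin_num_measure// muleC.
pose G : set (set (R * R)) :=
  [set E | exists A, measurable A /\ exists B, measurable B /\ E = A `*` B].
have : m1 D = m2 D.
  apply: (measure_unique G (fun=> setT)) => //.
  - rewrite measurable_prod_measurableType //; congr (<<s _ >>).
    rewrite predeqE; split => [[A mA [B mB <-]]|[A [mA [B [mB ->]]]]].
      by exists A; split => //; exists B.
    by exists A => //; exists B.
  - move=> /= _ _ [X1 [mX1 [X2 [mX2 ->]]]] [Y1 [mY1 [Y2 [mY2 ->]]]].
    rewrite -setXI; exists (X1 `&` Y1); split; first exact: measurableI.
    by exists (X2 `&` Y2); split => //; exact: measurableI.
  - move=> n; exists setT; split => //; exists setT; split => //.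
    by rewrite setXTT.
  - by rewrite bigcup_const//; exists 0%N.
  - move=> _ [A [mA [B [mB ->]]]].
    by rewrite [RHS]m2E -rect.
  - move=> _; rewrite /= /pushforward /mrestr.
    by rewrite (le_lt_trans (probability_le1 P _))// ?ltry// setTI.
by rewrite m2E => <-.
Qed.

Lemma partial_sum_independent (X : nat -> T -> R) (z : R -> R) :
  (forall j, measurable_fun [set: T] (X j)) -> mutually_independent P X ->
  measurable_fun [set: R] z ->
  forall i, independent2 P (fun w => \sum_(j < i) z (X j w)) (X i).
Proof.
move=> mX indX mz.
pose S i w := \sum_(j < i) z (X j w).
have mS i : measurable_fun [set: T] (S i).
  by apply: measurable_sum => j; exact: measurableT_comp.
have mpre (W : T -> R) A : measurable_fun [set: T] W -> measurable A ->
    measurable (W @^-1` A).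
  by move=> mW mA; rewrite -[X in measurable X]setTI; exact: mW.
have mcap (J : {fset nat}) (B : nat -> set R) : (forall j, measurable (B j)) ->
    measurable (\bigcap_(j in [set` J]) (X j @^-1` B j)).
  by move=> mB; apply: fin_bigcap_measurable => // j _; exact: mpre.
have cap1 i (B : set R) :
    \bigcap_(j in [set` [fset i]%fset]) X j @^-1` B = X i @^-1` B.
  by rewrite bigcap_fset big_seq_fset1.
(* The induction needs more than independence of [S i] and [X i]: [S i] must be independent of every
   finite family of variables of index at least [i], so that adding [X i] to the sum leaves the
   later ones independent of it. *)
have SX i (A : set R) (J : {fset nat}) (B : nat -> set R) : measurable A ->
    (forall j, measurable (B j)) -> (forall j, j \in J -> (i <= j)%N) ->
    P (S i @^-1` A `&` \bigcap_(j in [set` J]) (X j @^-1` B j)) =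
    (P (S i @^-1` A) * P (\bigcap_(j in [set` J]) (X j @^-1` B j)))%E.
  elim: i A J B => [|i IH] A J B mA mB iJ.
    have -> : S 0%N = cst 0 by apply/funext => w; rewrite /S big_ord0.
    rewrite preimage_cst; case: ifPn => _.
      by rewrite setTI [X in (X * _)%E](probability_setT P) mul1e.
    by rewrite set0I measure0 mul0e.
  pose C := \bigcap_(j in [set` J]) (X j @^-1` B j).
  (* An event on [X i] joined to [C] is again an event on a finite family, over [J] enlarged by [i],
     to which the induction hypothesis applies. *)
  have insertC B0 : measurable B0 ->
      X i @^-1` B0 `&` C = \bigcap_(j in [set` (i |` J)%fset])
        (X j @^-1` (if j == i then B0 else B j)).
    move=> mB0; apply/seteqP; split => [w [XB Cw] j /=|w Xw].
      rewrite !inE => /orP[/eqP ->|jJ]; first by rewrite eqxx.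
      by case: eqP => [->//|_]; exact: Cw.
    split; first by have /= := Xw i; rewrite fset1U1 eqxx; exact.
    move=> j /= jJ; have /= := Xw j; rewrite fset1Ur// => /(_ isT).
    by case: eqP => // ji; have := iJ _ jJ; rewrite ji ltnn.
  have iNJ : i \notin J by apply/negP => /iJ; rewrite ltnn.
  have XC B0 : measurable B0 -> P (X i @^-1` B0 `&` C) = (P (X i @^-1` B0) * P C)%E.
    move=> mB0; rewrite insertC// indX; last by move=> j; case: ifP.
    rewrite big_fsetU1//= eqxx; congr (_ * _)%E.
    rewrite /C indX//; apply: eq_big_seq => j jJ.
    by case: eqP => // ji; have := iJ _ jJ; rewrite ji ltnn.
  have SXi A0 B0 : measurable A0 -> measurable B0 ->
      P (S i @^-1` A0 `&` X i @^-1` B0) = (P (S i @^-1` A0) * P (X i @^-1` B0))%E.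
    move=> mA0 mB0; have := IH A0 [fset i]%fset (fun=> B0) mA0 (fun=> mB0).
    by rewrite cap1; apply => j; rewrite inE => /eqP ->.
  (* [S i.+1] is a function of the pair [(S i, X i)], so factorisation over rectangles of pairs is
     enough. *)
  have -> : S i.+1 @^-1` A =
      (fun w => (S i w, X i w)) @^-1` ((fun p : R * R => p.1 + z p.2) @^-1` A).
    by apply/seteqP; split => w; rewrite /S /= big_ord_recr.
  apply: rectangle_independent => //; first exact: mcap.
    move=> A0 B0 mA0 mB0; rewrite SXi// -setIA insertC// IH//.
    - by rewrite -insertC// XC// muleA.
    - by move=> j; case: ifP.
    - by move=> j; rewrite !inE => /orP[/eqP ->//|/iJ/ltnW].
  have mg : measurable_fun [set: R * R] (fun p : R * R => p.1 + z p.2).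
    by apply: measurable_funD => //; exact: measurableT_comp.
  by rewrite -[X in measurable X]setTI; exact: mg.
move=> i A B mA mB; have := SX i A [fset i]%fset (fun=> B) mA (fun=> mB).
by rewrite cap1; apply => j; rewrite inE => /eqP ->.
Qed.


(** By uniqueness almost everywhere, [g] is the Radon-Nikodym derivative of the law of [V], for
    which the change of variables is known. *)
Lemma has_density_Rintegral (V : {RV P >-> R}) (g z : R -> R) :
  has_density V g -> bounded_mfun z ->
  \int[P]_w z (V w) = \int[lebesgue_measure]_y (z y * g y).
Proof.
move=> [[mg g0 g1] gE] bz; have [mz _] := bz.
have ig : lebesgue_measure.-integrable [set: R] (EFin \o g).
  apply/integrableP; split; first exact/measurable_EFinP.
  by under eq_integral do rewrite /= ger0_norm//; rewrite g1 ltry.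
have mV : @measurable_fun _ _ T (measurableTypeR R) setT V.
  exact: (measurable_funPT V).
pose nu := distribution P (@mfun_Sub _ _ T (measurableTypeR R) V (mem_set mV)).
have dom : nu `<< lebesgue_measure.
  apply/null_content_dominatesP => A mA A0; rewrite [LHS]gE//.
  by apply: null_set_integral => //; apply: measurable_funTS; exact/measurable_EFinP.
have iz : nu.-integrable [set: measurableTypeR R] (EFin \o z).
  exact: bounded_integrable.
transitivity (\int[nu]_y z y).
  rewrite /Rintegral integral_pushforward//; first exact/measurable_EFinP.
  by apply: (bounded_integrable _ (f := z \o V)); exact: bounded_mfun_comp.
rewrite /Rintegral -(Radon_Nikodym_change_of_variables dom)//; congr fine.
have dg : ae_eq lebesgue_measure setT (EFin \o g)
    (Radon_Nikodym (charge_of_finite_measure nu) lebesgue_measure).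
  apply: integral_ae_eq => //.
  by move=> A _ mA; rewrite -Radon_Nikodym_integral//= -gE.
apply: ae_eq_integral => //.
- apply: emeasurable_funM; first exact/measurable_EFinP.
  exact: measurable_int (Radon_Nikodym_integrable _).
- by apply/measurable_EFinP; exact: measurable_funM.
- by apply: filterS dg => y /= gy /gy <-; rewrite EFinM.
Qed.

End independence.

(** * The heat flow of the standard normal distribution function *)

Section taylor_bounds.
Context {R : realType}.
Implicit Types (f df : R -> R) (x y B M : R).

Lemma is_derive_continuous f x c : is_derive x 1 f c -> {for x, continuous f}.
Proof. by move=> dfx; apply/differentiable_continuous/derivable1_diffP. Qed.

Lemma is_derive_mull (a t : R) : is_derive t 1 (fun s => a * s) a.
Proof.
change (is_derive t 1 (a \*: @id R) a).
by apply: is_derive_eq; rewrite /GRing.scale/= mulr1.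
Qed.

Lemma is_derive_mulsqr (a t : R) :
  is_derive t 1 (fun s => a * s ^+ 2) (a * (2 * t)).
Proof.
change (is_derive t 1 (a \*: (@id R ^+ 2)) (a * (2 * t))).
by apply: is_derive_eq; rewrite /GRing.scale/= expr1 mulr1.
Qed.

(** Running along [th * x] with [th] in [0, 1] treats both signs of [x] at once. *)
Lemma mvt_bound f df x B :
  (forall th, 0 <= th <= 1 -> is_derive (th * x) 1 f (df (th * x))) ->
  (forall th, 0 <= th <= 1 -> `|df (th * x)| <= B) ->
  `|f x - f 0| <= B * `|x|.
Proof.
move=> fd dB.
have dg th : th \in `[0, 1]%R ->
    is_derive (th : R) 1 (fun s : R => f (s * x)) (df (th * x) * x).
  rewrite in_itv/= => th01.
  have dM : is_derive th 1 (fun s : R => s * x) x.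
    by under eq_fun do rewrite mulrC; exact: is_derive_mull.
  exact: (@is_derive1_comp R f (fun s : R => s * x) th _ _ (fd _ th01) dM).
have dg' th : th \in `]0, 1[%R ->
    is_derive (th : R) 1 (fun s : R => f (s * x)) (df (th * x) * x).
  by move=> /subset_itv_oo_cc /dg.
have cg : {within `[0, 1], continuous (fun s : R => f (s * x))}.
  apply: derivable_within_continuous => th /dg dth.
  exact: ex_derive.
have [th] := MVT_segment ler01 dg' cg.
rewrite in_itv/= mul1r mul0r subr0 mulr1 => /dB dBth ->.
by rewrite normrM ler_wpM2r.
Qed.

Lemma is_derive_shifted f (c y t : R) :
  is_derive (y + t) 1 f c -> is_derive t 1 (fun s => f (y + s)) c.
Proof.
move=> fd; rewrite -[c]mulr1.
apply: (@is_derive1_comp R f (fun s : R => y + s) t _ _ fd).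
rewrite (_ : (fun s => y + s) = shift y); first exact: is_derive_shift.
by apply/funext => s /=; rewrite addrC.
Qed.

(** The derivatives are required only on the segment: this is applied in the time variable of the
    heat flow, which must stay positive. Two mean value estimates give [M] in place of the sharp
    [M / 2]. *)
Lemma taylor1_bound f f1 f2 x y M :
  (forall th, 0 <= th <= 1 -> is_derive (y + th * x) 1 f (f1 (y + th * x))) ->
  (forall th, 0 <= th <= 1 -> is_derive (y + th * x) 1 f1 (f2 (y + th * x))) ->
  (forall th, 0 <= th <= 1 -> `|f2 (y + th * x)| <= M) ->
  `|f (y + x) - f y - f1 y * x| <= M * `|x| ^+ 2.
Proof.
move=> fd f1d f2M.
have M0 : 0 <= M.
  by apply: le_trans (f2M 0 _); rewrite ?normr_ge0// lexx ler01.
pose g t := f (y + t) - f1 y * t.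
pose dg t := f1 (y + t) - f1 y.
have /= := @mvt_bound g dg x (M * `|x|).
rewrite /g addr0 mulr0 subr0 -addrA [_ - f y]addrC addrA expr2 mulrA; apply.
  move=> th th01; apply: is_deriveB.
    exact: is_derive_shifted (fd _ th01).
  exact: is_derive_mull.
move=> th th01.
have /= := @mvt_bound (fun t => f1 (y + t)) (fun t => f2 (y + t)) (th * x) M.
rewrite addr0 => bnd; apply: le_trans (bnd _ _) _.
- move=> s s01; apply: is_derive_shifted; rewrite mulrA; apply: f1d.
  by nra.
- move=> s s01; rewrite mulrA; apply: f2M; nra.
- rewrite ler_wpM2l// normrM ger0_norm; last by case/andP: th01.
  by rewrite ler_piMl//; case/andP: th01.
Qed.

(** The derivative of this remainder is the first-order remainder of [f1], so the preceding bound
    feeds the mean value estimate. *)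
Lemma taylor2_bound f f1 f2 f3 x y M :
  (forall z : R, is_derive z 1 f (f1 z)) ->
  (forall z : R, is_derive z 1 f1 (f2 z)) ->
  (forall z : R, is_derive z 1 f2 (f3 z)) -> (forall z, `|f3 z| <= M) ->
  `|f (y + x) - f y - f1 y * x - f2 y / 2 * x ^+ 2| <= M * `|x| ^+ 3.
Proof.
move=> fd f1d f2d f3M.
have M0 : 0 <= M by apply: le_trans (f3M 0); rewrite normr_ge0.
pose g t := f (y + t) - f1 y * t - f2 y / 2 * t ^+ 2.
pose dg t := f1 (y + t) - f1 y - f2 y * t.
have /= := @mvt_bound g dg x (M * `|x| ^+ 2).
rewrite /g addr0 mulr0 expr0n/= mulr0 !subr0.
have -> : f (y + x) - f1 y * x - f2 y / 2 * x ^+ 2 - f y =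
  f (y + x) - f y - f1 y * x - f2 y / 2 * x ^+ 2 by ring.
have -> : M * `|x| ^+ 3 = M * `|x| ^+ 2 * `|x| by ring.
apply.
  move=> th th01; apply: is_deriveB.
    apply: is_deriveB; first exact: is_derive_shifted.
    exact: is_derive_mull.
  rewrite (_ : f2 y * (th * x) = f2 y / 2 * (2 * (th * x))); last by field.
  exact: is_derive_mulsqr.
move=> th th01; apply: le_trans
  (taylor1_bound (fun _ _ => f1d _) (fun _ _ => f2d _) (fun _ _ => f3M _)) _.
rewrite ler_wpM2l// lerXn2r ?nnegrE// normrM ger0_norm; last by case/andP: th01.
by rewrite ler_piMl//; case/andP: th01.
Qed.

(** Both [g + f] and [g - f] have a nonnegative derivative on the interval; the sign is the
    parameter [e] of the proof. *)
Lemma derive_dominated (f g df dg : R -> R) (a b : R) : a <= b ->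
  (forall t, a <= t <= b -> is_derive t 1 f (df t)) ->
  (forall t, a <= t <= b -> is_derive t 1 g (dg t)) ->
  (forall t, a <= t <= b -> `|df t| <= dg t) ->
  `|f b - f a| <= g b - g a.
Proof.
move=> ab fd gd fg.
have sub t : t \in `]a, b[%R -> a <= t <= b.
  by rewrite in_itv/= => /andP[/ltW -> /ltW ->].
have der (e : R) t : a <= t <= b ->
    is_derive t 1 (g + e \*: f) (dg t + e *: df t).
  by move=> tab; have ? := fd t tab; have ? := gd t tab; exact: is_deriveD.
have mono (e : R) : `|e| = 1 -> g a + e * f a <= g b + e * f b.
  move=> e1.
  have dge t : t \in `]a, b[%R -> is_derive t 1 (g + e \*: f) (dg t + e *: df t).
    by move=> /sub; exact: der.
  have cge : {within `[a, b], continuous (g + e \*: f)}.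
    apply: derivable_within_continuous => t; rewrite in_itv/= => /(der e) dt.
    exact: ex_derive.
  have [c] := MVT_segment ab dge cge; rewrite in_itv/= => /fg dc E.
  rewrite -subr_ge0 (_ : _ - _ = (g + e \*: f) b - (g + e \*: f) a)// E.
  rewrite mulr_ge0 ?subr_ge0// /GRing.scale/= -lerBlDl sub0r.
  rewrite lerNl; apply: le_trans dc.
  by rewrite -[leRHS]mul1r -e1 -normrM -normrN ler_norm.
have := mono 1 (normr1 _); have := mono (-1) (normrN1 _).
by rewrite ler_norml; lra.
Qed.

End taylor_bounds.

(** * The standard normal density and distribution function *)

Section standard_normal.
Context {R : realType}.
Implicit Types r s a y : R.

Definition stdnormal_cdf r : R := fine (normal_prob 0 1 `]-oo, r]).
Local Notation Phi := stdnormal_cdf.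
Local Notation phi := (normal_pdf (0 : R) 1).

Lemma stdnormal_pdfE r : phi r = normal_peak 1 * expR (- (r ^+ 2 / 2)).
Proof. by rewrite normal_pdfE ?oner_neq0// /normal_fun subr0 expr1n mulNr. Qed.

Lemma stdnormal_cdf_ge0 r : 0 <= Phi r.
Proof. by rewrite fine_ge0// measure_ge0. Qed.

Lemma stdnormal_cdf_le1 r : Phi r <= 1.
Proof.
rewrite -lee_fin fineK; first exact: probability_le1.
exact: fin_num_measure.
Qed.

Lemma stdnormal_cdf_nd : {homo Phi : r s / r <= s}.
Proof.
move=> r s rs; rewrite fine_le ?fin_num_measure//.
rewrite le_measure ?inE//; exact: subitvPr.
Qed.

Lemma is_derive_stdnormal_cdf r : is_derive r 1 Phi (phi r).
Proof.
have intf u : lebesgue_measure.-integrable `]-oo, u] (EFin \o phi).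
  by apply: (integrableS measurableT) => //; exact: integrable_normal_pdf.
have [] := @continuous_FTC1 R phi -oo%O r (r + 1) _ (intf _) _ _.
- by rewrite ltrDl.
- by rewrite ltNyr.
- by apply: continuous_normal_pdf; rewrite oner_neq0.
move=> dF dE; apply: DeriveDef; first exact: dF.
by rewrite -derive1E.
Qed.

Lemma is_derive_stdnormal_pdf r : is_derive r 1 phi (- r * phi r).
Proof.
have -> : phi = normal_peak 1 \*: (expR \o (fun t => (- 2^-1) * t ^+ 2)).
  by apply/funext => t; rewrite stdnormal_pdfE/= mulNr [2^-1 * _]mulrC.
have d := is_derive_mulsqr (- 2^-1 : R) r.
have := is_deriveZ (normal_peak (1 : R)) (is_derive1_comp (is_derive_expR _) d).
move=> /is_derive_eq; apply.
change (normal_peak 1 * (expR (- 2^-1 * r ^+ 2) * (- 2^-1 * (2 * r))) =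
  - r * (normal_peak 1 * expR (- 2^-1 * r ^+ 2))).
by field.
Qed.

Lemma stdnormal_pdf_ge0 r : 0 <= phi r.
Proof. exact: normal_pdf_ge0. Qed.

Lemma stdnormal_peak_le1 : normal_peak (1 : R) <= 1.
Proof.
have h : (1 : R) <= pi *+ 2 by rewrite mulr2n; have := @pi_ge2 R; lra.
rewrite /normal_peak expr1n mul1r invf_le1.
  by rewrite -[leLHS]sqrtr1 ler_wsqrtr.
by rewrite sqrtr_gt0 (lt_le_trans ltr01 h).
Qed.

(** Squaring 1 + u <= exp u at u = r^2 / 4 gives (1 + r^2 / 4)^2 <= exp (r^2 / 2). Sixteen times the
    left side is at least 1 and at least r^4, hence dominates |r|^k. Powers up to 3 are those that
    occur in the derivatives of the heat flow. *)
Lemma stdnormal_pdf_moment r (k : nat) : (k <= 3)%N -> `|r| ^+ k * phi r <= 16.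
Proof.
move=> k3.
have eb : expR (- (r ^+ 2 / 2)) * (1 + r ^+ 2 / 4) ^+ 2 <= 1.
  have h : 1 + r ^+ 2 / 4 <= expR (r ^+ 2 / 4) by exact: expR_ge1Dx.
  have h0 : 0 <= 1 + r ^+ 2 / 4 by have := sqr_ge0 r; lra.
  have e1 : expR (- (r ^+ 2 / 2)) * expR (r ^+ 2 / 4) ^+ 2 = 1.
    by rewrite -expRM_natl -expRD -[RHS]expR0; congr expR; field.
  rewrite -[leRHS]e1.
  by rewrite ler_wpM2l ?expR_ge0// lerXn2r ?nnegrE// (le_trans h0).
have rk : `|r| ^+ k <= 16 * (1 + r ^+ 2 / 4) ^+ 2.
  rewrite -[r ^+ 2]real_normK ?num_real//; set t := `|r|.
  have t0 : 0 <= t by exact: normr_ge0.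
  have t2 := sqr_ge0 t.
  case: k k3 => [|[|[|[|//]]]] _.
  - by rewrite expr0; nra.
  - by rewrite expr1; nra.
  - by nra.
  - have [t1|t1] := leP 1 t.
      have : t ^+ 3 <= t ^+ 4 by rewrite ler_weXn2l.
      have -> : t ^+ 4 = (t ^+ 2) ^+ 2 by rewrite -exprM.
      by nra.
    have : t ^+ 3 <= 1 by rewrite exprn_ile1// ltW.
    by nra.
have p0 := normal_peak_ge0 (1 : R); have p1 := stdnormal_peak_le1.
rewrite stdnormal_pdfE.
have E0 : 0 <= expR (- (r ^+ 2 / 2)) by exact: expR_ge0.
apply: (@le_trans _ _ (16 * (1 + r ^+ 2 / 4) ^+ 2 * expR (- (r ^+ 2 / 2)))).
  rewrite ler_pM ?exprn_ge0// ?mulr_ge0//.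
  by rewrite ler_piMl.
by rewrite -mulrA [_ * expR _]mulrC; lra.
Qed.

End standard_normal.

(** * Derivatives of the heat flow and the one-step expansion *)

Section heat_flow.
Context {R : realType}.
Implicit Types r s a y x : R.
Local Notation Phi := (@stdnormal_cdf R).
Local Notation phi := (normal_pdf (0 : R) 1).

(* [heat a s y] is the probability that y + N(0, s) is at most a; it solves the
   heat equation, with first two space derivatives [heat1] and [heat2]. *)
Definition heat a s y : R := Phi ((a - y) / Num.sqrt s).
Definition heat1 a s y : R := - (phi ((a - y) / Num.sqrt s) / Num.sqrt s).
Definition heat2 a s y : R :=
  - ((a - y) / Num.sqrt s * phi ((a - y) / Num.sqrt s) / s).

Let is_derive_rphi r :
  is_derive r 1 (fun r => r * phi r) ((1 - r ^+ 2) * phi r).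
Proof.
have d := is_deriveM (is_derive_id r 1) (is_derive_stdnormal_pdf r).
by apply: (is_derive_eq d); rewrite /GRing.scale/=; ring.
Qed.

Let is_derive_standardize_y a s y :
  is_derive y 1 (fun y => (a - y) / Num.sqrt s) (- (Num.sqrt s)^-1).
Proof.
have d : is_derive y 1 (fun y : R => a - y) (-1).
  by rewrite -[-1]add0r; exact: (is_deriveB (is_derive_cst a y 1) (is_derive_id y 1)).
rewrite -mulN1r mulrC.
under eq_fun do rewrite mulrC.
exact: (@is_derive1_comp R (fun t : R => (Num.sqrt s)^-1 * t) (fun y : R => a - y)
  y _ _ (is_derive_mull _ _) d).
Qed.

Let is_derive_standardize_s a s y : 0 < s ->
  is_derive s 1 (fun s => (a - y) / Num.sqrt s)
    (- ((a - y) / Num.sqrt s / (2 * s))).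
Proof.
move=> s0; have q0 : Num.sqrt s != 0 by rewrite gt_eqF// sqrtr_gt0.
have d := is_deriveV q0 (is_derive1_sqrt s0).
have := is_derive1_comp (is_derive_mull (a - y) _) d.
move=> /is_derive_eq; apply; rewrite /GRing.scale/=.
rewrite (_ : 2 * s = 2 * Num.sqrt s ^+ 2); first by field.
by rewrite sqr_sqrtr// ltW.
Qed.

Lemma is_derive_heat a s y : is_derive y 1 (heat a s) (heat1 a s y).
Proof.
rewrite /heat1 -mulrN.
exact: (is_derive1_comp (is_derive_stdnormal_cdf _) (is_derive_standardize_y _ _ _)).
Qed.

Lemma is_derive_heat1 a s y : 0 < s ->
  is_derive y 1 (heat1 a s) (heat2 a s y).
Proof.
move=> s0; have q0 : Num.sqrt s != 0 by rewrite gt_eqF// sqrtr_gt0.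
have d := is_derive1_comp (is_derive_stdnormal_pdf _) (is_derive_standardize_y a s y).
have := is_derive1_comp (is_derive_mull (- (Num.sqrt s)^-1) _) d.
have -> : (fun t : R => - (Num.sqrt s)^-1 * t) \o
    (phi \o (fun y => (a - y) / Num.sqrt s)) = heat1 a s.
  by apply/funext => z /=; rewrite /heat1 mulNr mulrC.
move=> /is_derive_eq; apply; rewrite /heat2.
rewrite (_ : s^-1 = (Num.sqrt s ^+ 2)^-1); first by field.
by rewrite sqr_sqrtr// ltW.
Qed.

Definition heat3 a s y : R :=
  (1 - ((a - y) / Num.sqrt s) ^+ 2) * phi ((a - y) / Num.sqrt s)
  / (s * Num.sqrt s).

Lemma is_derive_heat2 a s y : 0 < s ->
  is_derive y 1 (heat2 a s) (heat3 a s y).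
Proof.
move=> s0; have q0 : Num.sqrt s != 0 by rewrite gt_eqF// sqrtr_gt0.
have d := is_derive1_comp (is_derive_rphi _) (is_derive_standardize_y a s y).
have := is_derive1_comp (is_derive_mull (- s^-1) _) d.
have -> : (fun t : R => - s^-1 * t) \o
    ((fun r => r * phi r) \o (fun y => (a - y) / Num.sqrt s)) = heat2 a s.
  by apply/funext => z /=; rewrite /heat2 mulNr mulrC.
move=> /is_derive_eq; apply; rewrite /heat3.
by field; rewrite q0 gt_eqF.
Qed.

Lemma is_derive_heat_s a s y : 0 < s ->
  is_derive s 1 (fun s => heat a s y) (heat2 a s y / 2).
Proof.
move=> s0; have q0 : Num.sqrt s != 0 by rewrite gt_eqF// sqrtr_gt0.
have d := is_derive1_comp (is_derive_stdnormal_cdf _) (is_derive_standardize_s a y s0).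
by apply: (is_derive_eq d); rewrite /heat2; field; rewrite q0 gt_eqF.
Qed.

(** The time derivative of [heat2], which by the heat equation is half the fourth space derivative
    of [heat]. *)
Definition heat2_s a s y : R := let r := (a - y) / Num.sqrt s in
  (3 / 2 * r - r ^+ 3 / 2) * phi r / s ^+ 2.

Lemma is_derive_heat2_s a s y : 0 < s ->
  is_derive s 1 (fun s => heat2 a s y / 2) (heat2_s a s y / 2).
Proof.
move=> s0; have q0 : Num.sqrt s != 0 by rewrite gt_eqF// sqrtr_gt0.
have s0' : s != 0 by rewrite gt_eqF.
have d := is_derive1_comp (is_derive_rphi _) (is_derive_standardize_s a y s0).
have di := is_deriveV (f := id) s0' (is_derive_id s 1).
have dd := is_deriveM d di.
have := is_derive1_comp (is_derive_mull (- 2^-1) _) dd.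
have -> : (fun t : R => - 2^-1 * t) \o (((fun r => r * phi r) \o
    (fun s => (a - y) / Num.sqrt s)) * (fun s => (id s)^-1)) =
    (fun s => heat2 a s y / 2).
  apply/funext => z /=; rewrite /heat2 [RHS]mulrC mulNr mulrN; congr (- (_ * _)).
move=> /is_derive_eq; apply; rewrite /heat2_s/= /GRing.scale/=.
by field; rewrite q0 s0'.
Qed.

Lemma heat_bounded a s y : 0 <= heat a s y <= 1.
Proof. by rewrite stdnormal_cdf_ge0 stdnormal_cdf_le1. Qed.

(** This bound and the next ones are uniform over times [s >= dlt]; they degenerate as [dlt] tends
    to 0, where the flow approaches an indicator function. *)
Lemma heat1_bound dlt a s y : 0 < dlt -> dlt <= s ->
  `|heat1 a s y| <= 16 / Num.sqrt dlt.
Proof.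
move=> d0 ds; rewrite normrN normrM ger0_norm ?stdnormal_pdf_ge0//.
have m0 := @stdnormal_pdf_moment R ((a - y) / Num.sqrt s) 0 isT.
rewrite ler_pM ?stdnormal_pdf_ge0//; first by rewrite expr0 mul1r in m0.
rewrite ger0_norm ?invr_ge0 ?sqrtr_ge0//.
by rewrite lef_pV2 ?posrE ?sqrtr_gt0 ?ler_wsqrtr// (lt_le_trans d0).
Qed.

Lemma heat2_bound dlt a s y : 0 < dlt -> dlt <= s ->
  `|heat2 a s y| <= 16 / dlt.
Proof.
move=> d0 ds; have s0 := lt_le_trans d0 ds.
rewrite normrN !normrM (ger0_norm (stdnormal_pdf_ge0 _)).
rewrite [X in _ * X]gtr0_norm ?invr_gt0//.
have m1 := @stdnormal_pdf_moment R ((a - y) / Num.sqrt s) 1 isT.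
rewrite ler_pM ?mulr_ge0 ?stdnormal_pdf_ge0// ?invr_ge0 ?(ltW s0)//.
  by rewrite -normrM -[X in X * _]expr1.
by rewrite lef_pV2.
Qed.

Lemma heat3_bound dlt a s y : 0 < dlt -> dlt <= s ->
  `|heat3 a s y| <= 32 / (dlt * Num.sqrt dlt).
Proof.
move=> d0 ds; have s0 := lt_le_trans d0 ds.
have q0 : 0 < Num.sqrt s by rewrite sqrtr_gt0.
have p0 : 0 < Num.sqrt dlt by rewrite sqrtr_gt0.
rewrite /heat3 normrM [X in _ * X]gtr0_norm ?invr_gt0 ?mulr_gt0//.
set r := (a - y) / _.
have f0 := @stdnormal_pdf_ge0 R r.
have m0 := @stdnormal_pdf_moment R r 0 isT.
have m2 := @stdnormal_pdf_moment R r 2 isT.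
rewrite expr0 mul1r in m0; rewrite real_normK ?num_real// in m2.
rewrite ler_pM ?invr_ge0 ?mulr_ge0 ?(ltW s0) ?(ltW q0)//.
  have := sqr_ge0 r; rewrite ler_norml; nra.
by rewrite lef_pV2 ?posrE ?mulr_gt0// ler_pM ?ler_wsqrtr ?(ltW d0) ?(ltW p0).
Qed.

Lemma heat2_s_bound dlt a s y : 0 < dlt -> dlt <= s ->
  `|heat2_s a s y / 2| <= 32 / dlt ^+ 2.
Proof.
move=> d0 ds; have s0 := lt_le_trans d0 ds.
rewrite /heat2_s; set r := (a - y) / _.
have f0 := @stdnormal_pdf_ge0 R r.
have m1 := @stdnormal_pdf_moment R r 1 isT.
have m3 := @stdnormal_pdf_moment R r 3 isT.
have -> : (3 / 2 * r - r ^+ 3 / 2) * phi r / s ^+ 2 / 2 =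
  (3 / 4 * (r * phi r) - (r ^+ 3 * phi r) / 4) / s ^+ 2.
  by field; rewrite gt_eqF.
rewrite normrM [X in _ * X]gtr0_norm ?invr_gt0 ?exprn_gt0//.
rewrite ler_pM ?invr_ge0 ?exprn_ge0 ?(ltW s0)//.
  have n1 : `|r * phi r| <= 16 by rewrite normrM (ger0_norm f0).
  have n3 : `|r ^+ 3 * phi r| <= 16 by rewrite normrM normrX (ger0_norm f0).
  by move: n1 n3; rewrite !ler_norml; lra.
by rewrite lef_pV2 ?posrE ?exprn_gt0// lerXn2r// ?nnegrE ltW.
Qed.

(** Expand to second order in space and to first order in time, both from [(s, y)]. By the heat
    equation the time term is [heat2 a s y / 2 * D], so it merges with the quadratic space term into
    the factor [x ^+ 2 - D], which averages to zero when [D] is the variance of [x]. *)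
Lemma heat_step dlt a s y x D : 0 < dlt -> dlt <= s -> 0 <= D ->
  `|heat a s (y + x) - heat a (s + D) y - heat1 a s y * x
    - heat2 a s y / 2 * (x ^+ 2 - D)|
  <= 32 / (dlt * Num.sqrt dlt) * `|x| ^+ 3 + 32 / dlt ^+ 2 * D ^+ 2.
Proof.
move=> d0 ds D0; have s0 := lt_le_trans d0 ds.
have tx := taylor2_bound x y (is_derive_heat a s)
  (fun z => is_derive_heat1 a z s0) (fun z => is_derive_heat2 a z s0)
  (fun z => heat3_bound a z d0 ds).
have sD th : 0 <= th <= 1 -> dlt <= s + th * D.
  by case/andP => th0 _; rewrite (le_trans ds)// lerDl mulr_ge0.
have sD0 th : 0 <= th <= 1 -> 0 < s + th * D.
  by move=> /sD; exact: lt_le_trans.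
have ts := @taylor1_bound R (fun s => heat a s y)
  (fun s => heat2 a s y / 2) (fun s => heat2_s a s y / 2) D s _
  (fun th th01 => is_derive_heat_s a y (sD0 th th01))
  (fun th th01 => is_derive_heat2_s a y (sD0 th th01))
  (fun th th01 => heat2_s_bound a y d0 (sD th th01)).
rewrite [in X in _ <= X](ger0_norm D0) in ts.
set A := (X in `|X| <= _) in tx; set B := (X in `|X| <= _) in ts.
rewrite (_ : _ - _ = A - B); last first.
  rewrite /A /B; move: (heat a s (y + x)) (heat a s y) (heat a (s + D) y).
  by move: (heat1 a s y) (heat2 a s y) => *; ring.
by rewrite (le_trans (ler_normB _ _))// lerD.
Qed.

End heat_flow.

(** * Tails and scaling of the normal distribution *)

Section normal_facts.
Context {R : realType}.
Implicit Types r s a y sg : R.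
Local Notation Phi := (@stdnormal_cdf R).

Lemma continuous_stdnormal_cdf : continuous Phi.
Proof. by move=> r; exact: is_derive_continuous (is_derive_stdnormal_cdf r). Qed.

Lemma bounded_mfun_heat a s : bounded_mfun (heat a s).
Proof.
split.
  apply: continuous_measurable_fun => y.
  exact: is_derive_continuous (is_derive_heat a s y).
by exists 1 => y; have /andP[h0 h1] := heat_bounded a s y; rewrite ger0_norm.
Qed.

Lemma bounded_mfun_heat1 a s : 0 < s -> bounded_mfun (heat1 a s).
Proof.
move=> s0; split.
  apply: continuous_measurable_fun => y.
  exact: is_derive_continuous (is_derive_heat1 a y s0).
by exists (16 / Num.sqrt s) => y; exact: heat1_bound.
Qed.

Lemma bounded_mfun_heat2 a s : 0 < s -> bounded_mfun (heat2 a s).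
Proof.
move=> s0; split.
  apply: continuous_measurable_fun => y.
  exact: is_derive_continuous (is_derive_heat2 a y s0).
by exists (16 / s) => y; exact: heat2_bound.
Qed.

(** [Phi] is the distribution function of the identity under N(0, 1), so it has the limits at
    infinity of any distribution function. *)
Lemma stdnormal_cdf_tails (e : R) : 0 < e ->
  exists k, [/\ 0 < k, 1 - Phi k <= e & Phi (- k) <= e].
Proof.
move=> e0.
pose N : probability (measurableTypeR R) R := normal_prob 0 1.
have mid : @measurable_fun _ _ (measurableTypeR R) R setT id.
  exact: measurable_id.
pose X : {RV N >-> R} := @mfun_Sub _ _ (measurableTypeR R) R id (mem_set mid).
have cy : Phi r @[r --> +oo] --> (1 : R).
  by have /fine_cvg := cvg_cdfy1 X; apply.
have cNy : Phi (- r) @[r --> +oo] --> (0 : R).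
  have /fine_cvg := cvg_cdfNy0 X.
  by rewrite cvgNy_compNP; apply.
near (pinfty_nbhs R) => k.
exists k; split.
- by near: k; exact: nbhs_pinfty_gt.
- rewrite lerBlDr -lerBlDl.
  near: k; have e1 : 1 - e < 1 by rewrite ltrBlDr ltrDl.
  exact: (cvgr_ge _ cy).
- by near: k; exact: (cvgr_le _ cNy).
Unshelve. all: by end_near. Qed.


Lemma normal_prob_itvNy sg a : 0 < sg ->
  normal_prob 0 sg `]-oo, a] = (Phi (a / sg))%:E.
Proof.
move=> sg0.
rewrite /stdnormal_cdf fineK; last exact: fin_num_measure.
have dF : forall z : R, is_derive z 1 (fun y : R => sg^-1 * y) sg^-1.
  by move=> z; exact: is_derive_mull.
have dF1 : (fun y : R => sg^-1 * y)^`()%classic = cst sg^-1.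
  by apply/funext => z; rewrite derive1E derive_val.
rewrite [a / sg]mulrC /normal_prob.
rewrite (@increasing_ge0_integration_by_substitutionNy R (fun y => sg^-1 * y)).
- apply: eq_integral => y _; congr EFin; rewrite dF1.
  change (normal_pdf 0 sg y = normal_pdf 0 1 (sg^-1 * y) * sg^-1).
  rewrite stdnormal_pdfE.
  rewrite normal_pdfE ?gt_eqF// /normal_peak /normal_fun subr0 expr1n mul1r.
  rewrite -mulrnAr sqrtrM ?sqr_ge0// sqrtr_sqr gtr0_norm// invfM.
  rewrite [in RHS]mulrC mulrA; congr (_ * expR _).
  by field; rewrite gt_eqF.
- by move=> x y _ _ xy; rewrite ltr_pM2l// invr_gt0.
- by rewrite dF1 => z _; exact: cst_continuous.
- by rewrite dF1; exact: is_cvg_cst.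
- by rewrite dF1; exact: cvg_cst.
- split; first by move=> z _; exact: ex_derive.
  apply: cvg_at_left_filter.
  exact: is_derive_continuous (dF a).
- by apply: gt0_cvgMrNy; rewrite ?invr_gt0.
- apply: continuous_subspaceT.
  by apply: continuous_normal_pdf; rewrite oner_neq0.
- by move=> z _; exact: normal_pdf_ge0.
Qed.

End normal_facts.

(** * The central limit theorem for bounded triangular arrays *)

Section lindeberg.
Context d (T : measurableType d) (R : realType) (P : probability T R).
Variable X : nat -> T -> R.
Hypothesis mX : forall j, measurable_fun [set: T] (X j).
Hypothesis indX : mutually_independent P X.
Hypothesis idX : identically_distributed P X.

Lemma identically_distributed_Rintegral (z : R -> R) i j : bounded_mfun z ->
  \int[P]_w z (X i w) = \int[P]_w z (X j w).
Proof.
move=> bz.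
have E k : \int[P]_w z (X k w) =
    \int[distribution P (mfun_Sub (mem_set (mX k)))]_y z y.
  rewrite /Rintegral integral_pushforward//.
    by apply/measurable_EFinP; case: bz.
  by apply: (bounded_integrable _ (f := z \o X k)); exact: bounded_mfun_comp.
rewrite !E; congr fine; apply: eq_measure_integral => A mA _.
exact: idX.
Qed.

(** The error is [n] times that of one [heat_step]; as [c] is the inverse square root of [n], it
    vanishes in the limit for fixed [C] and [dlt] and bounded [v]. *)
Lemma lindeberg_bound (z : R -> R) (C a dlt v c : R) (n : nat) :
  measurable_fun [set: R] z -> (forall y, `|z y| <= C) ->
  0 < dlt -> (0 < n)%N -> \int[P]_w z (X 0%N w) = 0 ->
  \int[P]_w (z (X 0%N w) ^+ 2) = v -> c = (Num.sqrt n%:R)^-1 ->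
  `|\int[P]_w heat a dlt (c * \sum_(j < n) z (X j w)) - heat a (dlt + v) 0| <=
  n%:R * (32 / (dlt * Num.sqrt dlt) * (c * C) ^+ 3 +
          32 / dlt ^+ 2 * (c ^+ 2 * v) ^+ 2).
Proof.
move=> mz zC d0 n0 Ez Ev cE.
have bz : bounded_mfun z by split => //; exists C.
have nR0 : 0 < n%:R :> R by rewrite ltr0n.
have c0 : 0 < c by rewrite cE invr_gt0 sqrtr_gt0.
have c2 : c ^+ 2 = n%:R^-1 by rewrite cE exprVn sqr_sqrtr// ltW.
have v0 : 0 <= v by rewrite -Ev; apply: Rintegral_ge0 => w _; exact: sqr_ge0.
have bc (k : R) : bounded_mfun (fun _ : R => k) by exact: bounded_mfun_cst.
have bcz : bounded_mfun (fun y => c * z y) by exact: bounded_mfunM.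
have bcz2 : bounded_mfun (fun y => (c * z y) ^+ 2) by exact: bounded_mfunM.
pose S i w := \sum_(j < i) z (X j w).
have mS i : measurable_fun [set: T] (S i).
  by apply: measurable_sum => j; exact: measurableT_comp.
pose D := c ^+ 2 * v.
have D0 : 0 <= D by rewrite mulr_ge0// sqr_ge0.
(* [t i] is the smoothing time plus the variance of the summands not yet added. It runs from
   [dlt + v], since n D = v, down to [dlt]. *)
pose t i := dlt + D * (n - i)%:R.
have dt i : dlt <= t i by rewrite lerDl mulr_ge0.
pose F i := \int[P]_w heat a (t i) (c * S i w).
set e := 32 / (dlt * _) * _ + _.
have mc : measurable_fun [set: R] (fun y : R => c * y) by exact: measurable_funM.
have step i : (i < n)%N -> `|F i.+1 - F i| <= e.
  move=> ilt; set s := t i.+1.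
  have s0 : 0 < s by exact: lt_le_trans d0 (dt _).
  have tE : t i = s + D.
    by rewrite /s /t -(subnSK ilt) -natr1; ring.
  have bS (f : R -> R) k : bounded_mfun f -> bounded_mfun (fun w => f (c * S k w)).
    by move=> bf; apply: (bounded_mfun_comp (mS k) (f := fun y => f (c * y)));
      exact: bounded_mfun_comp.
  (* The two terms that [heat_step] keeps out of its error. Both have mean zero, as [S i] is
     independent of [X i]: the first by centring, the second because [D] is the variance of
     [c * z]. *)
  pose G1 w := heat1 a s (c * S i w) * (c * z (X i w)).
  pose G2 w := heat2 a s (c * S i w) / 2 * ((c * z (X i w)) ^+ 2 - D).
  have bX (f : R -> R) : bounded_mfun f -> bounded_mfun (fun w => f (X i w)).
    exact: bounded_mfun_comp.
  have bG1 : bounded_mfun G1.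
    by apply: bounded_mfunM; [exact/bS/bounded_mfun_heat1|exact: (bX _ bcz)].
  have bh2 : bounded_mfun (fun y => heat2 a s y / 2).
    by apply: bounded_mfunM => //; exact: bounded_mfun_heat2.
  have bg2 : bounded_mfun (fun y => (c * z y) ^+ 2 - D) by exact: bounded_mfunB.
  have bG2 : bounded_mfun G2.
    by apply: bounded_mfunM; [exact: (bS _ _ bh2)|exact: (bX _ bg2)].
  have ind := partial_sum_independent mX indX mz i.
  have bcomp (f : R -> R) : bounded_mfun f -> bounded_mfun (fun y => f (c * y)).
    exact: bounded_mfun_comp.
  have G10 : \int[P]_w G1 w = 0.
    rewrite (independent2_Rintegral (mS i) (mX i) ind
      (bcomp _ (bounded_mfun_heat1 a s0)) bcz).
    rewrite [X in _ * X](_ : _ = 0) ?mulr0//.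
    rewrite Rintegral_boundedZl; last exact: bX.
    by rewrite (identically_distributed_Rintegral i 0 bz) Ez mulr0.
  have G20 : \int[P]_w G2 w = 0.
    rewrite (independent2_Rintegral (mS i) (mX i) ind (bcomp _ bh2) bg2).
    rewrite [X in _ * X](_ : _ = 0) ?mulr0//.
    rewrite (identically_distributed_Rintegral i 0 bg2).
    rewrite Rintegral_boundedB; last 2 first.
    - exact: (bounded_mfun_comp (mX 0) bcz2).
    - exact: bounded_mfun_cst.
    rewrite Rintegral_prob_cst.
    under eq_Rintegral do rewrite exprMn.
    rewrite Rintegral_boundedZl ?Ev ?subrr//.
    by apply: (bounded_mfun_comp (mX 0) (f := fun y => z y ^+ 2)); exact: bounded_mfunM.
  pose E w := heat a s (c * S i.+1 w) - heat a (s + D) (c * S i w) - G1 w - G2 w.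
  have -> : F i.+1 - F i = \int[P]_w E w.
    rewrite Rintegral_boundedB// ?G20 ?subr0; last first.
      by apply: bounded_mfunB => //; apply: bounded_mfunB; apply: bS;
        exact: bounded_mfun_heat.
    rewrite Rintegral_boundedB// ?G10 ?subr0; last first.
      by apply: bounded_mfunB; apply: bS; exact: bounded_mfun_heat.
    rewrite Rintegral_boundedB; last 2 first.
    - by apply: bS; exact: bounded_mfun_heat.
    - by apply: bS; exact: bounded_mfun_heat.
    by rewrite /F tE.
  apply: norm_Rintegral_le.
    by do 2 apply: bounded_mfunB => //; apply: bounded_mfunB; apply: bS;
      exact: bounded_mfun_heat.
  move=> w; rewrite /E /G1 /G2 /S big_ord_recr/= mulrDr.
  apply: le_trans (heat_step _ _ _ d0 (dt _) D0) _.
  rewrite lerD2r ler_wpM2l ?mulr_ge0 ?invr_ge0 ?mulr_ge0 ?sqrtr_ge0 ?(ltW d0)//.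
  by rewrite lerXn2r ?nnegrE ?mulr_ge0 ?normr_ge0 ?(ltW c0)//
    ?(le_trans (normr_ge0 (z 0)))// normrM (gtr0_norm c0) ler_wpM2l// ltW.
have tel i : (i <= n)%N -> `|F i - F 0%N| <= i%:R * e.
  elim: i => [|i IH] ilt; first by rewrite subrr normr0 mul0r.
  rewrite -[F _](subrK (F i)) -addrA (le_trans (ler_normD _ _))//.
  rewrite -[i.+1%:R]natr1 mulrDl mul1r [leRHS]addrC.
  exact: lerD (step _ ilt) (IH (ltnW ilt)).
have := tel n (leqnn n); rewrite /F /t subnn mulr0 addr0 subn0.
rewrite /D c2 mulrAC mulVf ?mul1r ?gt_eqF//.
under [X in _ - X]eq_Rintegral do rewrite /S big_ord0 mulr0.
by rewrite Rintegral_prob_cst.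
Qed.

End lindeberg.

Lemma cvg_invsqrtn (R : realType) :
  (Num.sqrt n%:R)^-1 @[n --> \oo] --> (0 : R).
Proof.
have -> : (fun n => (Num.sqrt (n%:R : R))^-1) = (fun n => Num.sqrt (n%:R^-1)).
  by apply/funext => n; rewrite sqrtrV.
rewrite -[X in _ --> X](@sqrtr0 R).
apply: (@continuous_cvg _ _ _ _ _ _ Num.sqrt); first exact: sqrt_continuous.
apply/gtr0_cvgV0; last exact: cvgr_idn.
by exists 1%N => // n /= n0; rewrite ltr0n.
Qed.

(** * From smoothed expectations to distribution functions *)

Section triangular_array.
Context d (T : measurableType d) (R : realType) (P : probability T R).
Variable X : nat -> T -> R.
Hypothesis iidX : iid P X.
Variables (z : nat -> R -> R) (C sg : R).
Hypothesis mz : forall n, measurable_fun [set: R] (z n).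
Hypothesis zC : \forall n \near \oo, forall y, `|z n y| <= C.
Hypothesis Ez : forall n, \int[P]_w z n (X 0%N w) = 0.
Hypothesis sg0 : 0 < sg.
Hypothesis Ev : \int[P]_w (z n (X 0%N w) ^+ 2) @[n --> \oo] --> sg ^+ 2.

Let W n w := (Num.sqrt n%:R)^-1 * \sum_(j < n) z n (X j w).

Let mW n : measurable_fun [set: T] (W n).
Proof.
have [mX _ _] := iidX.
apply: measurable_funM => //; apply: measurable_sum => j.
exact: measurableT_comp.
Qed.

Lemma array_smooth_cvg (a dlt : R) : 0 < dlt ->
  \int[P]_w heat a dlt (W n w) @[n --> \oo] --> heat a (dlt + sg ^+ 2) 0.
Proof.
move=> d0; have [mX indX idX] := iidX.
pose v n := \int[P]_w (z n (X 0%N w) ^+ 2).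
pose c n : R := (Num.sqrt n%:R)^-1.
pose K1 := 32 / (dlt * Num.sqrt dlt); pose K2 := 32 / dlt ^+ 2.
have cv : heat a (dlt + v n) 0 @[n --> \oo] --> heat a (dlt + sg ^+ 2) 0.
  have s0 : 0 < dlt + sg ^+ 2 by rewrite addr_gt0// exprn_gt0.
  apply: (@continuous_cvg _ _ _ _ _ _ (fun s => heat a s 0)).
    exact: (@is_derive_continuous R (fun s => heat a s 0) _ _ (is_derive_heat_s a 0 s0)).
  by apply: cvgD; [exact: cvg_cst|exact: Ev].
have c0 : c n @[n --> \oo] --> (0 : R) by exact: cvg_invsqrtn.
(* The error of [lindeberg_bound] simplified by n c^2 = 1: both terms vanish with [c]. *)
pose B n := K1 * C ^+ 3 * c n + K2 * v n ^+ 2 * c n ^+ 2.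
have B0 : B n @[n --> \oo] --> (0 : R).
  rewrite -[X in _ --> X](_ : K1 * C ^+ 3 * 0 + K2 * (sg ^+ 2) ^+ 2 * 0 ^+ 2 = 0).
    apply: cvgD; apply: cvgM => //; first exact: cvg_cst.
      apply: cvgM; first exact: cvg_cst.
      by rewrite expr2; under eq_fun do rewrite expr2; exact: cvgM.
    by rewrite expr2; under eq_fun do rewrite expr2; exact: cvgM.
  by rewrite mulr0 expr0n/= mulr0 addr0.
rewrite -[X in _ --> X]add0r.
have -> : (fun n => \int[P]_w heat a dlt (W n w)) =
    (fun n => (\int[P]_w heat a dlt (W n w) - heat a (dlt + v n) 0) +
              heat a (dlt + v n) 0).
  by apply/funext => n; rewrite subrK.
apply: cvgD => //; apply/norm_cvg0P.
apply: (@squeeze_cvgr _ _ _ _ (cst 0) B) => //; last exact: cvg_cst.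
near=> n.
have n0 : (0 < n)%N by near: n; exists 1%N.
rewrite normr_ge0/=.
have zCn : forall y, `|z n y| <= C by near: n.
have := lindeberg_bound mX indX idX a (mz n) zCn d0 n0 (Ez n) erefl erefl.
rewrite -/(c n) -/(v n) -/(W n) -/K1 -/K2 => /le_trans; apply.
have cn : n%:R * c n ^+ 2 = 1.
  by rewrite exprVn sqr_sqrtr// divff// pnatr_eq0 -lt0n.
rewrite -[leRHS]mul1r -[X in X * B n]cn le_eqVlt; apply/orP; left; apply/eqP.
by rewrite /B; ring.
Unshelve. all: by end_near. Qed.

(** At time t^2 the flow is [Phi] of the distance to the threshold in units of [t]. Moving the
    threshold by [k * t] brings it within [e] of 0 above [a], respectively within [e] of 1 below
    [a], where the comparison with the indicator could fail. *)
Let cdf_between (a e k t : R) n : 0 < t -> 0 < k ->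
  1 - stdnormal_cdf k <= e -> stdnormal_cdf (- k) <= e ->
  \int[P]_w heat (a - k * t) (t ^+ 2) (W n w) - e
  <= fine (P (W n @^-1` `]-oo, a]))
  <= \int[P]_w heat (a + k * t) (t ^+ 2) (W n w) + e.
Proof.
move=> t0 k0 k1 k2.
have mA : measurable (W n @^-1` `]-oo, a]).
  by rewrite -[X in measurable X]setTI; exact: mW.
have e0 : 0 <= e by rewrite (le_trans _ k2)// stdnormal_cdf_ge0.
have inA w : (w \in W n @^-1` `]-oo, a]) = (W n w <= a).
  by apply/idP/idP; rewrite inE/= in_itv.
have bA := bounded_mfun_indic R mA.
have bH b : bounded_mfun (fun w => heat b (t ^+ 2) (W n w)).
  exact: (bounded_mfun_comp (mW n) (bounded_mfun_heat _ _)).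
have bE : bounded_mfun (fun _ : T => e) by exact: bounded_mfun_cst.
have st : Num.sqrt (t ^+ 2) = t by rewrite sqrtr_sqr gtr0_norm.
rewrite -(Rintegral_indic P mA); apply/andP; split.
  rewrite -[X in _ - X](Rintegral_prob_cst P e) -Rintegral_boundedB//.
  apply: le_Rintegral_bounded => //.
    exact: bounded_mfunB.
  move=> w; rewrite indicE inA /heat st; have [aw|wa] := leP (W n w) a.
    by rewrite lerBlDr (le_trans (stdnormal_cdf_le1 _))// lerDl.
  rewrite subr_le0 (le_trans _ k2)// stdnormal_cdf_nd//.
  by rewrite ler_pdivrMr// mulNr; lra.
rewrite -[X in _ + X](Rintegral_prob_cst P e) -Rintegral_boundedD//.
apply: le_Rintegral_bounded => //; first exact: bounded_mfunD.
move=> w; rewrite indicE inA /heat st; have [aw|wa] := leP (W n w) a.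
  have : stdnormal_cdf k <= stdnormal_cdf ((a + k * t - W n w) / t).
    by rewrite stdnormal_cdf_nd// ler_pdivlMr//; lra.
  by rewrite mulr1n; lra.
by rewrite addr_ge0// stdnormal_cdf_ge0.
Qed.

Theorem bounded_array_clt (a : R) :
  fine (P (W n @^-1` `]-oo, a])) @[n --> \oo] --> stdnormal_cdf (a / sg).
Proof.
apply/cvgrPdist_le => e e0.
(* One third each for the tails, the removal of the smoothing and the convergence in [n]. *)
have e3 : 0 < e / 3 by rewrite divr_gt0.
have [k [k0 k1 k2]] := stdnormal_cdf_tails e3.
(* The limit from [array_smooth_cvg] at time t^2 with the threshold moved by [b * t]. With [b] fixed
   as [k] or [- k], shift and smoothing vanish together as [t] decreases to 0. *)
pose G (b t : R) := heat (a + b * t) (t ^+ 2 + sg ^+ 2) 0.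
have G0 b : G b t @[t --> 0^'+] --> stdnormal_cdf (a / sg).
  apply: cvg_at_right_filter.
  rewrite /G /heat.
  apply: (@continuous_cvg _ _ _ _ _ _ (@stdnormal_cdf R)).
    exact: continuous_stdnormal_cdf.
  have s0 : Num.sqrt (0 ^+ 2 + sg ^+ 2) = sg.
    by rewrite expr0n/= add0r sqrtr_sqr gtr0_norm.
  under eq_fun do rewrite subr0.
  suff : (a + b * t) / Num.sqrt (t ^+ 2 + sg ^+ 2) @[t --> (0 : R)] -->
      (a + b * 0) / Num.sqrt (0 ^+ 2 + sg ^+ 2).
    by rewrite s0 mulr0 addr0.
  apply: cvgM.
    by apply: cvgD; [exact: cvg_cst|apply: cvgM; [exact: cvg_cst|exact: cvg_id]].
  apply: cvgV; first by rewrite s0 gt_eqF.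
  apply: (@continuous_cvg _ _ _ _ _ _ Num.sqrt); first exact: sqrt_continuous.
  apply: cvgD; last exact: cvg_cst.
  by rewrite expr2; under eq_fun do rewrite expr2; apply: cvgM; exact: cvg_id.
have [t [t0 tp tm]] : exists t, [/\ 0 < t,
    `|stdnormal_cdf (a / sg) - G k t| <= e / 3 &
    `|stdnormal_cdf (a / sg) - G (- k) t| <= e / 3 ].
  near (0 : R)^'+ => t; exists t; split => //.
  - by near: t; move/cvgrPdist_le : (G0 k); exact.
  - by near: t; move/cvgrPdist_le : (G0 (- k)); exact.
have t20 : 0 < t ^+ 2 by rewrite exprn_gt0.
have Sp := @array_smooth_cvg (a + k * t) (t ^+ 2) t20.
have Sm := @array_smooth_cvg (a - k * t) (t ^+ 2) t20.
rewrite -[heat _ _ 0]/(G k t) in Sp.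
rewrite (_ : heat _ _ 0 = G (- k) t) in Sm; last by rewrite /G mulNr.
move/cvgrPdist_le : Sp => /(_ _ e3) Sp.
move/cvgrPdist_le : Sm => /(_ _ e3) Sm.
apply: filterS2 Sp Sm => n up dn.
have /andP[lo hi] := cdf_between a n t0 k0 k1 k2.
move: up dn tp tm lo hi; move: (G k t) (G (- k) t) (\int[P]_w _) (\int[P]_w _).
move: (stdnormal_cdf _) (fine _) => p q x1 x2 x3 x4.
by rewrite !ler_norml; lra.
Unshelve. all: by end_near. Qed.

End triangular_array.

(** * Asymptotics of an oscillatory integral *)

Section oscillatory_integral.
Context {R : realType}.
Variables mu l : R.
Hypotheses (mu0 : 0 < mu) (l1 : 1 < l).
Implicit Types A b t h : R.

Let l0 : 0 < l. Proof. exact: lt_trans l1. Qed.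

Definition expint_fun b t : R := cos (t * b) * expR (t `^ l / mu).
(** With b = X_j - x and A = 1 / h this is, up to the factor 1 / pi, the term of the observation X_j
    in the average that forms the estimator. *)
Definition expint b A : R := \int[lebesgue_measure]_(t in `[0, A]) expint_fun b t.

Lemma measurable_expint_fun b : measurable_fun [set: R] (expint_fun b).
Proof.
apply: measurable_funM.
  apply: (measurableT_comp (f := cos)); last exact: measurable_funM.
  by apply: continuous_measurable_fun; exact: continuous_cos.
by apply: measurableT_comp => //; exact: measurable_funM.
Qed.

Lemma integrable_expint_fun b A :
  lebesgue_measure.-integrable `[0, A] (EFin \o expint_fun b).
Proof.
apply: measurable_bounded_integrable => //.
- by rewrite [X in (X < _)%E]lebesgue_measure_itv/=; case: ifP => _;
    rewrite ?ltry// -EFinB ltry.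
- exact: measurable_funS (measurable_expint_fun b).
- exists (expR (A `^ l / mu)); split; first exact: num_real.
  move=> M AM t /=; rewrite in_itv/= => /andP[t0 tA].
  rewrite (le_trans _ (ltW AM))// /expint_fun normrM.
  rewrite [X in _ * X]ger0_norm ?expR_ge0//.
  rewrite -[leRHS]mul1r ler_pM ?expR_ge0//; first by rewrite ler_norml cos_geN1 cos_le1.
  rewrite ler_expR ler_pM2r ?invr_gt0// ge0_ler_powR ?nnegrE ?(ltW l0)//.
  exact: le_trans tA.
Qed.

Let is_derive_exppow A : 0 < A ->
  is_derive A 1 (fun t => expR (t `^ l / mu))
    (expR (A `^ l / mu) * (l * A `^ (l - 1) / mu)).
Proof.
move=> A0.
have d := is_derive1_comp (is_derive_mull mu^-1 _) (is_derive1_powR l A0).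
have := is_derive1_comp (is_derive_expR _) d.
have -> : expR \o ((fun s : R => mu^-1 * s) \o (@powR R)^~ l) =
    (fun t => expR (t `^ l / mu)).
  by apply/funext => t /=; rewrite mulrC.
by move=> /is_derive_eq; apply => /=; rewrite [mu^-1 * _]mulrC [mu^-1 * (l * _)]mulrC.
Qed.

Let is_derive_cosM b A :
  is_derive A 1 (fun t => cos (t * b)) (- sin (A * b) * b).
Proof.
have := is_derive1_comp (is_derive_cos _) (is_derive_mull b A).
have -> : cos \o (fun s : R => b * s) = (fun t => cos (t * b)).
  by apply/funext => t /=; rewrite mulrC.
by move=> /is_derive_eq; apply; rewrite mulrC [b * A]mulrC mulrC.
Qed.

Lemma is_derive_expint b A : 0 < A -> is_derive A 1 (expint b) (expint_fun b A).
Proof.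
move=> A0.
have AA : A < A + 1 by rewrite ltrDl.
have cA : {for A, continuous (expint_fun b)}.
  have := is_deriveM (is_derive_cosM b A) (is_derive_exppow A0).
  exact: is_derive_continuous.
have [dF FE] := continuous_FTC1_closed AA (integrable_expint_fun b _) A0 cA.
by apply: DeriveDef; [exact: dF|rewrite -derive1E].
Qed.

(** Since E = kap t^(1 - l) E', integrating cos(t b) E(t) by parts produces the boundary term that
    [J] subtracts. What remains of the integrand is of order t^(1 - l) E(t), which is the order of
    the derivative of [G]. *)
Let kap := mu / l.
Let E A := expR (A `^ l / mu).
Let J b A := expint b A - kap * (A `^ (1 - l) * cos (A * b) * E A).
Let G A := A `^ (2 - 2 * l) * E A.

Let gt0_powRD A r s : 0 < A -> A `^ (r + s) = A `^ r * A `^ s.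
Proof. by move=> A0; rewrite powRD// (gt_eqF A0) implybT. Qed.

Let powRl A : 0 < A -> A `^ (1 - l) * A `^ (l - 1) = 1.
Proof.
move=> A0; rewrite -gt0_powRD//.
by rewrite (_ : _ + _ = 0) ?powRr0//; ring.
Qed.

Let is_derive_J b A : 0 < A -> is_derive A 1 (J b)
  (kap * ((l - 1) * A `^ (- l) * cos (A * b) + A `^ (1 - l) * (b * sin (A * b))) * E A).
Proof.
move=> A0.
have d1 := is_derive1_powR (1 - l) A0.
have d2 := is_deriveM (is_deriveM d1 (is_derive_cosM b A)) (is_derive_exppow A0).
have d3 := is_deriveB (is_derive_expint b A0) (is_deriveZ kap d2).
apply: (is_derive_eq d3).
rewrite /GRing.scale/= -/(E A) /expint_fun -/(E A).
rewrite [1 - l - 1]addrAC subrr add0r.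
change (cos (A * b) * E A - kap * ((A `^ (1 - l) * cos (A * b)) *
   (E A * (l * A `^ (l - 1) / mu)) + E A * (A `^ (1 - l) *
   (- sin (A * b) * b) + cos (A * b) * ((1 - l) * A `^ (- l)))) =
  kap * ((l - 1) * A `^ (- l) * cos (A * b) +
    A `^ (1 - l) * (b * sin (A * b))) * E A).
(* Differentiating the factor [E] of the main term reproduces the integrand exactly, and the two
   cancel. *)
have h : kap * (A `^ (1 - l) * (l * A `^ (l - 1) / mu)) = 1.
  rewrite -[RHS](powRl A0) /kap; field; rewrite !gt_eqF//.
set p := A `^ (1 - l) in h *; set q := A `^ (l - 1) in h *.
rewrite -[cos (A * b) * E A]mulr1 -h; ring.
Qed.

Let is_derive_G A : 0 < A -> is_derive A 1 G
  (A `^ (1 - l) * E A * (l / mu - (2 * l - 2) * A `^ (- l))).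
Proof.
move=> A0.
have d := is_deriveM (is_derive1_powR (2 - 2 * l) A0) (is_derive_exppow A0).
apply: (is_derive_eq d); rewrite /GRing.scale/= -/(E A).
have -> : A `^ (2 - 2 * l) = A `^ (1 - l) * A `^ (1 - l).
  by rewrite -gt0_powRD//; congr (_ `^ _); ring.
have -> : A `^ (2 - 2 * l - 1) = A `^ (1 - l) * A `^ (- l).
  by rewrite -gt0_powRD//; congr (_ `^ _); ring.
have h := powRl A0.
set p := A `^ (1 - l) in h *; set q := A `^ (l - 1) in h *.
rewrite (_ : l / mu = p * q * (l / mu)); last by rewrite h mul1r.
ring.
Qed.

(** Beyond [A0] one has (2 l - 2) t^(-l) <= l / (2 mu), so the derivative of [G] is at least l / (2
    mu) times t^(1 - l) E(t). The factor 2 mu / l in [M] compensates for this constant, the rest of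
    [M] bounds the derivative of [J]. *)
Let A0 := Num.max 1 ((2 * l - 2) * (2 * mu / l)).
Let M b := kap * ((l - 1) + `|b|) * (2 * mu / l).

Let A0_ge1 : 1 <= A0. Proof. by rewrite le_max lexx. Qed.

Let A0_gt0 : 0 < A0. Proof. exact: lt_le_trans A0_ge1. Qed.

Let kap_ge0 : 0 <= kap. Proof. by rewrite divr_ge0 ?ltW. Qed.

Let M_ge0 b : 0 <= M b.
Proof.
rewrite !mulr_ge0// ?invr_ge0 ?(ltW l0) ?(ltW mu0)//.
by rewrite addr_ge0// subr_ge0 ltW.
Qed.

Let dJ_le b t : A0 <= t ->
  `|kap * ((l - 1) * t `^ (- l) * cos (t * b) + t `^ (1 - l) * (b * sin (t * b)))
    * E t| <= M b * (t `^ (1 - l) * E t * (l / mu - (2 * l - 2) * t `^ (- l))).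
Proof.
move=> A0t; have t1 : 1 <= t by exact: le_trans A0t.
have t0 : 0 < t by exact: lt_le_trans t1.
have rp : t `^ (- l) <= t `^ (1 - l) by rewrite ler_powR// lerDr.
have rA : (2 * l - 2) * t `^ (- l) <= l / (2 * mu).
  have rt : t `^ (- l) <= A0^-1.
    apply: (@le_trans _ _ (t `^ (-1))); first by rewrite ler_powR// lerN2 ltW.
    by rewrite powR_inv1 ?(ltW t0)// lef_pV2 ?posrE.
  apply: (@le_trans _ _ ((2 * l - 2) * A0^-1)).
    by rewrite ler_wpM2l// subr_ge0 ler_peMr// ltW.
  rewrite ler_pdivrMr// -ler_pdivrMl ?divr_gt0 ?mulr_gt0//.
  by rewrite invf_div mulrC le_max lexx orbT.
have e0 : 0 < E t by exact: expR_gt0.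
have r0 : 0 <= t `^ (- l) by exact: powR_ge0.
have p0 : 0 <= t `^ (1 - l) by exact: powR_ge0.
have c1 : `|cos (t * b)| <= 1 by rewrite ler_norml cos_geN1 cos_le1.
have s1 : `|sin (t * b)| <= 1 by rewrite ler_norml sin_geN1 sin_le1.
move: (cos _) (sin _) (t `^ (- l)) (t `^ (1 - l)) (E t) c1 s1 r0 p0 e0 rp rA.
move=> c s r p e c1 s1 r0 p0 e0 rp rA.
rewrite 2!normrM (ger0_norm kap_ge0) (gtr0_norm e0).
apply: (@le_trans _ _ (kap * (((l - 1) + `|b|) * p) * e)).
  apply: (ler_wpM2r (ltW e0)); apply: (ler_wpM2l kap_ge0).
  rewrite [leRHS]mulrDl; apply: (le_trans (ler_normD _ _)); apply: lerD.
    rewrite 2!normrM (ger0_norm r0) [X in X * r * _]gtr0_norm ?subr_gt0//.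
    rewrite -mulrA; apply: ler_wpM2l; first by rewrite subr_ge0 ltW.
    by rewrite -[leRHS]mulr1 ler_pM.
  rewrite 2!normrM (ger0_norm p0) mulrC; apply: ler_wpM2r => //.
  by rewrite -[leRHS]mulr1 ler_wpM2l.
rewrite /M.
have -> : kap * (l - 1 + `|b| ) * (2 * mu / l) * (p * e * (l / mu - (2 * l - 2) * r)) =
   kap * ((l - 1 + `|b|) * p) * e * ((2 * mu / l) * (l / mu - (2 * l - 2) * r)).
  by ring.
have lb0 : 0 <= l - 1 + `|b| by rewrite addr_ge0// subr_ge0 ltW.
rewrite ler_peMr ?(mulr_ge0 (mulr_ge0 kap_ge0 (mulr_ge0 lb0 p0)) (ltW e0))//.
have c0 : 2 * mu / l * (l / (2 * mu)) = 1 by field; rewrite !gt_eqF.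
rewrite -[leLHS]c0.
rewrite ler_wpM2l ?divr_ge0 ?mulr_ge0 ?(ltW mu0) ?(ltW l0)//.
have : l / mu = 2 * (l / (2 * mu)) by field; rewrite gt_eqF.
by move: rA; lra.
Qed.

Let J_bound b A : A0 <= A -> `|J b A| <= `|J b A0| + M b * G A.
Proof.
move=> A0A.
have pos t : A0 <= t <= A -> 0 < t by move=> /andP[At _]; exact: lt_le_trans At.
have dGM t : A0 <= t <= A -> is_derive t 1 (M b \*: G)
    (M b * (t `^ (1 - l) * E t * (l / mu - (2 * l - 2) * t `^ (- l)))).
  by move=> tA; have dG := is_derive_G (pos _ tA); exact: (is_deriveZ (M b) dG).
have dom := derive_dominated A0A (fun t tA => is_derive_J b (pos t tA)) dGM
  (fun t tA => dJ_le b (proj1 (andP tA))).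
have G0 : 0 <= M b * G A0.
  by apply: (mulr_ge0 (M_ge0 b)); rewrite mulr_ge0 ?powR_ge0 ?expR_ge0.
rewrite -[J b A](subrK (J b A0)) (le_trans (ler_normD _ _))// addrC lerD2l.
apply: le_trans dom _.
change (M b * G A - M b * G A0 <= M b * G A).
by rewrite gerBl.
Qed.

(** The initial value of [J] at [A0] is reduced to order 1 / A because E(A) >= A^l / mu; the growth
    of [J] contributes the term A^(1 - l) through [G]. The constant depends on [b]. *)
Lemma expint_asymp b : exists a c, 0 < a /\ forall A, a <= A ->
  `|A `^ (l - 1) / expR (A `^ l / mu) * expint b A - mu / l * cos (A * b)| <=
  c * (A^-1 + A `^ (1 - l)).
Proof.
exists A0, (`|J b A0| * mu + M b); split=> // A A0A.
have A_gt0 : 0 < A by exact: lt_le_trans A0A.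
have e0 : 0 < E A by exact: expR_gt0.
have q0 : 0 <= A `^ (l - 1) by exact: powR_ge0.
have h := powRl A_gt0.
rewrite -/(E A) -/kap.
have -> : A `^ (l - 1) / E A * expint b A - kap * cos (A * b) =
    A `^ (l - 1) / E A * J b A.
  have -> : kap * cos (A * b) = kap * (A `^ (1 - l) * A `^ (l - 1)) * cos (A * b).
    by rewrite h mulr1.
  rewrite /J; move: (expint b A) (cos (A * b)) (A `^ _) (A `^ _) (E A) e0.
  by move=> I0 c0 p q e e0; field; rewrite gt_eqF.
have qe : A `^ (l - 1) / E A <= mu * A^-1.
  rewrite ler_pdivrMr//.
  have : A `^ l / mu <= E A by rewrite (le_trans _ (expR_ge1Dx _))// lerDr.
  have -> : A `^ (l - 1) = mu * A^-1 * (A `^ l / mu).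
    rewrite gt0_powRD// powR_inv1 ?(ltW A_gt0)//; field; rewrite !gt_eqF//.
  by move=> ?; rewrite ler_wpM2l ?mulr_ge0 ?invr_ge0 ?(ltW mu0) ?(ltW A_gt0).
rewrite normrM (ger0_norm (divr_ge0 q0 (ltW e0))).
apply: (@le_trans _ _ (A `^ (l - 1) / E A * (`|J b A0| + M b * G A))).
  by rewrite ler_wpM2l ?divr_ge0 ?(ltW e0)// J_bound.
rewrite mulrDr.
have -> : A `^ (l - 1) / E A * (M b * G A) = M b * A `^ (1 - l).
  rewrite /G (_ : 2 - 2 * l = (1 - l) + (1 - l)); last by ring.
  rewrite (gt0_powRD (1 - l) (1 - l) A_gt0) -[RHS]mulr1 -[X in _ = _ * X]h.
  move: (M b) (A `^ _) (A `^ _) (E A) e0 => m p q e e0.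
  by field; rewrite gt_eqF.
have j0 : A `^ (l - 1) / E A * `|J b A0| <= `|J b A0| * mu * A^-1.
  by rewrite mulrC -mulrA ler_wpM2l.
apply: le_trans (lerD j0 (lexx _)) _.
have := M_ge0 b; have : 0 <= A^-1 by rewrite invr_ge0 ltW.
have := powR_ge0 A (1 - l); have : 0 <= `|J b A0| * mu by rewrite mulr_ge0 ?(ltW mu0).
by nra.
Qed.

Lemma expint_fun_le b t : `|expint_fun b t| <= expint_fun 0 t.
Proof.
rewrite /expint_fun mulr0 cos0 normrM [X in _ * X]gtr0_norm ?expR_gt0//.
by rewrite ler_pM2r ?expR_gt0// ler_norml cos_geN1 cos_le1.
Qed.

(** This gives the measurability of a summand as a function of the observation; [expint_fun 0] is
    the dominating function. *)
Lemma continuous_expint A : continuous (fun b => expint b A).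
Proof.
move=> b; apply: (@continuity_under_integral R _ _ lebesgue_measure expint_fun
  `[0, A]%classic _ (b - 1) (b + 1) _ _ (expint_fun 0)) => //.
- by move=> ? _; exact: integrable_expint_fun.
- apply: aeW => t _ c _.
  have -> : expint_fun^~ t = expR (t `^ l / mu) \*: (fun c => cos (c * t)).
    by apply/funext => u; rewrite /expint_fun mulrC; congr (_ * cos _); rewrite mulrC.
  exact: is_derive_continuous (is_deriveZ _ (is_derive_cosM t c)).
- exact: integrable_expint_fun.
- by move=> c _; apply: aeW => t _; exact: expint_fun_le.
- by rewrite inE/= in_itv/= ltrDl ltrBlDr ltrDl ltr01.
Qed.

(** Supplies the uniformity in [b] that [expint_asymp] does not have. *)
Lemma expint_le b A : `|expint b A| <= expint 0 A.
Proof.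
apply: (le_trans (le_normr_Rintegral _ (integrable_expint_fun b A))) => //.
apply: le_Rintegral => //.
- exact: integrable_norm (integrable_expint_fun b A).
- exact: integrable_expint_fun.
- by move=> t _; exact: expint_fun_le.
Qed.

End oscillatory_integral.

Lemma Rintegral_sym_itv (R : realType) (g : R -> R) (A : R) : 0 <= A ->
  (forall t, g (- t) = g t) ->
  lebesgue_measure.-integrable `[- A, A] (EFin \o g) ->
  measurable_fun [set: R] g ->
  \int[lebesgue_measure]_(t in `[- A, A]) g t =
  2 * \int[lebesgue_measure]_(t in `[0, A]) g t.
Proof.
move=> A0 gN ig mg.
have mid := Rintegral_itvB ig (x := 0).
rewrite !bnd_simp oppr_le0 in mid; have {}mid := mid A0 A0.
have pos : \int[lebesgue_measure]_(t in `]0, A]) g t =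
    \int[lebesgue_measure]_(t in `[0, A]) g t.
  apply: Rintegral_itv_obnd_cbnd; apply: integrableS ig => //.
  by apply: subset_itvr; rewrite bnd_simp oppr_le0.
have neg : \int[lebesgue_measure]_(t in `[- A, 0]) g t =
    \int[lebesgue_measure]_(t in `[0, A]) g t.
  have pre : -%R @^-1` `[- A, 0] = `[0, A]%classic.
    by apply/seteqP; split => t /=; rewrite !in_itv/=; lra.
  pose G : R -> \bar R := EFin \o g.
  have gNE : G \o -%R = G by apply/funext => t; rewrite /G/= gN.
  congr fine; transitivity (integral (pushforward lebesgue_measure
      (-%R : _ -> measurableTypeR R)) (`[- A, 0]%classic : set (measurableTypeR R)) G).
    by apply: eq_measure_integral => B mB _; apply/esym; exact: lebesgue_measureN.
  rewrite integral_pushforward//.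
  - by rewrite pre gNE.
  - exact/measurable_EFinP.
  - rewrite pre gNE /G; apply: integrableS ig => //.
    by apply: subset_itvr; rewrite bnd_simp oppr_le0.
rewrite neg pos in mid.
by move/eqP : mid; rewrite subr_eq => /eqP ->; rewrite mulrDl mul1r.
Qed.

(** * The deconvolution estimator *)

Lemma Rintegral_sum_ord d (T : measurableType d) (R : realType)
    (mu : {measure set T -> \bar R}) (D : set T) (f : nat -> T -> R) n :
  measurable D -> (forall j, mu.-integrable D (EFin \o f j)) ->
  \int[mu]_(t in D) (\sum_(j < n) f j t) = \sum_(j < n) \int[mu]_(t in D) f j t.
Proof.
move=> mD fi.
have si m : mu.-integrable D (EFin \o (fun t => \sum_(j < m) f j t)).
  have -> : EFin \o (fun t => \sum_(j < m) f j t) =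
      (fun t => (\sum_(j < m) (f j t)%:E)%E).
    by apply/funext => t /=; rewrite sumEFin.
  by apply: integrable_sum => // j _; exact: fi.
elim: n => [|n IH].
  under eq_Rintegral do rewrite big_ord0.
  by rewrite big_ord0 /Rintegral integral0_eq.
under eq_Rintegral do rewrite big_ord_recr/=.
by rewrite (RintegralD mD (si n) (fi n)) IH big_ord_recr.
Qed.

Section estimator.
Context d (T : measurableType d) (R : realType).
Variables (mu l : R) (k : R -> R).
Hypotheses (mu0 : 0 < mu) (l1 : 1 < l).
Hypothesis phik : forall t, fourier k t = (expR (- (`|t| `^ l / mu)))%:C.

(** For one observation, the real part of the integrand of the estimator within the cutoff, up to
    the factor 1 / n; it extends [expint_fun] evenly to negative [t]. *)
Let even_fun (b t : R) : R := cos (t * b) * expR (`|t| `^ l / mu).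

Let even_funN b t : even_fun b (- t) = even_fun b t.
Proof. by rewrite /even_fun mulNr cosN normrN. Qed.

Let measurable_even_fun b : measurable_fun [set: R] (even_fun b).
Proof.
apply: measurable_funM.
  apply: (measurableT_comp (f := cos)); last exact: measurable_funM.
  by apply: continuous_measurable_fun; exact: continuous_cos.
apply: measurableT_comp => //; apply: measurable_funM => //.
by apply: (measurableT_comp (measurable_powR l)).
Qed.

Let integrable_even_fun b A :
  lebesgue_measure.-integrable `[- A, A] (EFin \o even_fun b).
Proof.
apply: measurable_bounded_integrable => //.
- by rewrite [X in (X < _)%E]lebesgue_measure_itv/=; case: ifP => _;
    rewrite ?ltry// -EFinB ltry.
- exact: measurable_funS (measurable_even_fun b).
- exists (expR (A `^ l / mu)); split; first exact: num_real.
  move=> M AM t /=; rewrite in_itv/= => tA.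
  rewrite (le_trans _ (ltW AM))// /even_fun normrM.
  rewrite [X in _ * X]ger0_norm ?expR_ge0//.
  rewrite -[leRHS]mul1r ler_pM ?expR_ge0//; first by rewrite ler_norml cos_geN1 cos_le1.
  have tA' : `|t| <= A by rewrite ler_norml.
  rewrite ler_expR ler_pM2r ?invr_gt0// ge0_ler_powR ?nnegrE//.
    by rewrite ltW// (lt_trans ltr01).
  exact: le_trans tA'.
Qed.

Let Rintegral_even_fun b A : 0 <= A ->
  \int[lebesgue_measure]_(t in `[- A, A]) even_fun b t = 2 * expint mu l b A.
Proof.
move=> A0; rewrite (Rintegral_sym_itv A0 (even_funN b)
  (integrable_even_fun b A) (measurable_even_fun b)).
apply: (congr1 ( *%R 2)).
by apply: eq_Rintegral => t; rewrite inE/= in_itv/= => /andP[t0 _];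
  rewrite /even_fun ger0_norm.
Qed.

(** The sinc transform cuts the integral to [-1 / h, 1 / h], the real part turns each exponential
    into a cosine, and evenness gives a factor 2 that cancels the one in 1 / (2 pi). *)
Lemma deconv_estimatorE (X : nat -> T -> R) n h x w : 0 < h ->
  deconv_estimator phi_sinc (fourier k) X n h x w =
  n%:R^-1 * \sum_(j < n) (pi^-1 * expint mu l (X j w - x) h^-1).
Proof.
move=> h0; rewrite /deconv_estimator /deconv_integral /cintegral.
have ReM (c : R) (z : R[i]) : complex.Re (c%:C * z) = c * complex.Re z.
  by case: z => a b /=; rewrite mul0r subr0.
rewrite ReM.
have A0 : 0 <= h^-1 by rewrite invr_ge0 ltW.
pose G t := \sum_(j < n) even_fun (X j w - x) t.
have E t : complex.Re (expi (- (t * x)) *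
    (phi_sinc (h * t) * phi_emp X n w t / fourier k t)) =
    ((fun t => n%:R^-1 * G t) \_ (`[- h^-1, h^-1])) t.
  rewrite /phi_emp phik.
  have -> : expi (- (t * x)) * (phi_sinc (h * t) *
      (n%:R^-1 * (\sum_(j < n) expi (t * X j w))) / (expR (- (`|t| `^ l / mu)))%:C) =
      (\1_`[-1, 1] (h * t) * n%:R^-1 * expR (`|t| `^ l / mu))%:C *
      \sum_(j < n) expi (t * (X j w - x)).
    under [in RHS]eq_bigr do rewrite mulrBr addrC expiD.
    rewrite -mulr_sumr /phi_sinc; move: (\1__ (h * t)) => i0.
    rewrite !rmorphM expRN !fmorphV rmorph_nat invrK.
    move: (expi _) (\sum_(_ < _) _) (_^-1) => a b c.
    by ring.
  rewrite ReM raddf_sum/= patchE.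
  have -> : (t \in `[- h^-1, h^-1]%classic) = (h * t \in `[-1, 1]%classic).
    apply/idP/idP; rewrite !inE/= !in_itv/=.
      by rewrite -ler_pdivlMl// -ler_pdivrMl// mulrN1 mulr1.
    by rewrite -ler_pdivlMl// -ler_pdivrMl// mulrN1 mulr1.
  rewrite indicE; case: ifP => _; last by rewrite !mul0r.
  rewrite mul1r -mulrA; congr (_ * _); rewrite mulr_sumr.
  by apply: eq_bigr => j _; rewrite /even_fun mulrC.
under eq_Rintegral do rewrite E.
rewrite -Rintegral_mkcond RintegralZl//; last first.
  have -> : EFin \o G = (fun t => (\sum_(j < n) (even_fun (X j w - x) t)%:E)%E).
    by apply/funext => t /=; rewrite sumEFin.
  by apply: integrable_sum => // j _; exact: integrable_even_fun.
rewrite /= (@Rintegral_sum_ord _ _ _ lebesgue_measure _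
  (fun j => even_fun (X j w - x)))//.
rewrite mulrCA mulr_sumr; apply: (congr1 ( *%R _)); apply: eq_bigr => j _.
rewrite [X in _ * X](Rintegral_even_fun _ A0) mulrA; apply: (congr1 ( *%R^~ _)).
by rewrite invfM mulrAC mulVf ?mul1r// pnatr_eq0.
Qed.

End estimator.

Lemma bounded_mfun_cos (R : realType) (a b : R) :
  bounded_mfun (fun y : R => cos (a * (y - b))).
Proof.
split; last by exists 1 => y; rewrite ler_norml cos_geN1 cos_le1.
apply: (measurableT_comp (f := cos)).
  by apply: continuous_measurable_fun; exact: continuous_cos.
by apply: measurable_funM => //; exact: measurable_funB.
Qed.

Lemma bounded_mfun_sin (R : realType) (a b : R) :
  bounded_mfun (fun y : R => sin (a * (y - b))).
Proof.
split; last by exists 1 => y; rewrite ler_norml sin_geN1 sin_le1.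
apply: (measurableT_comp (f := sin)).
  by apply: continuous_measurable_fun; exact: continuous_sin.
by apply: measurable_funM => //; exact: measurable_funB.
Qed.

(* The characteristic function of [Y + Z] is a product whose second factor is
   the real number [phi]. *)
Lemma cos_expectation_le d (T : measurableType d) (R : realType)
    (P : probability T R) (Y Z : {RV P >-> R}) (k : R -> R) (t x phi : R) :
  independent2 P Y Z -> has_density Z k -> fourier k t = phi%:C -> 0 <= phi ->
  `|\int[P]_w cos (t * (Y w + Z w - x))| <= phi.
Proof.
move=> YZ kZ ft phi0.
have mY : measurable_fun [set: T] Y by [].
have mZ : measurable_fun [set: T] Z by [].
have bcY := bounded_mfun_cos t x; have bsY := bounded_mfun_sin t x.
have bcZ := bounded_mfun_cos t 0; have bsZ := bounded_mfun_sin t 0.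
have bc := bounded_mfun_comp mY bcY; have bs := bounded_mfun_comp mY bsY.
have bc' := bounded_mfun_comp mZ bcZ; have bs' := bounded_mfun_comp mZ bsZ.
have Ec : \int[P]_w cos (t * (Z w - 0)) = phi.
  rewrite (has_density_Rintegral kZ bcZ); move: ft => [fc _]; rewrite -[RHS]fc.
  by apply: eq_Rintegral => y _; rewrite subr0 /= mulr0 subr0.
have Es : \int[P]_w sin (t * (Z w - 0)) = 0.
  rewrite (has_density_Rintegral kZ bsZ); move: ft => [_ fs]; rewrite -[RHS]fs.
  by apply: eq_Rintegral => y _; rewrite subr0 /= mulr0 add0r.
(* The shift [x] is absorbed by [Y], so that the sine mean of [Z] is the imaginary part of its
   characteristic function, which is zero. *)
under eq_Rintegral => w _.
  rewrite (_ : t * (Y w + Z w - x) = t * (Y w - x) + t * (Z w - 0)); last by ring.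
  rewrite cosD; over.
rewrite Rintegral_boundedB; [|exact: bounded_mfunM..].
rewrite (independent2_Rintegral mY mZ YZ bcY bcZ).
rewrite (independent2_Rintegral mY mZ YZ bsY bsZ) Ec Es mulr0 subr0.
rewrite normrM (ger0_norm phi0) -[leRHS]mul1r ler_wpM2r//.
apply: norm_Rintegral_le => // w.
by rewrite ler_norml cos_geN1 cos_le1.
Qed.

(** * Mean and variance of the normalised summand *)

Section deconvolution_asymptotics.
Context d (T : measurableType d) (R : realType) (P : probability T R).
Variables (mu l x : R) (X : T -> R) (h : nat -> R).
Hypotheses (mu0 : 0 < mu) (l1 : 1 < l).
Hypothesis mX : measurable_fun [set: T] X.
Hypothesis cosX : forall t, `|\int[P]_w cos (t * (X w - x))| <=
  expR (- (`|t| `^ l / mu)).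
Hypotheses (h_gt0 : forall n, 0 < h n) (h0 : h n @[n --> \oo] --> (0 : R)).

Definition deconv_scale n : R := h n `^ (l - 1) * expR (1 / (mu * h n `^ l)).
Definition deconv_summand n y : R :=
  (deconv_scale n)^-1 * (pi^-1 * expint mu l (y - x) (h n)^-1).

Let l0 : 0 < l. Proof. exact: lt_trans l1. Qed.

Let powR_inv (r a : R) : 0 < r -> r^-1 `^ a = (r `^ a)^-1.
Proof. by move=> r0; rewrite -powR_inv1 ?ltW// -powRrM mulN1r powRN. Qed.

(** Written with A = 1 / h, this is the factor in front of the integral in [expint_asymp]. *)
Lemma deconv_scaleV n : (deconv_scale n)^-1 =
  (h n)^-1 `^ (l - 1) / expR ((h n)^-1 `^ l / mu).
Proof.
rewrite /deconv_scale invfM !powR_inv//; congr (_ * (expR _)^-1).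
by rewrite div1r invfM mulrC.
Qed.

Lemma deconv_scale_gt0 n : 0 < deconv_scale n.
Proof. by rewrite mulr_gt0 ?powR_gt0 ?expR_gt0. Qed.

(** Positivity of [h] makes its limit one-sided, the form in which the limit of a power at 0 is
    available. *)
Let h_right : h n @[n --> \oo] --> 0^'+.
Proof.
move=> S [e e0 eS]; move/cvgrPdist_lt : h0 => /(_ e e0).
by apply: filterS => n ne; apply: eS.
Qed.

Let hl0 : h n `^ (l - 1) @[n --> \oo] --> (0 : R).
Proof.
have : a `^ (l - 1) @[a --> 0^'+] --> (0 : R) by apply: powR_cvg0; rewrite subr_gt0.
exact: cvg_comp h_right.
Qed.

Let V_gt a : \forall n \near \oo, a <= (h n)^-1.
Proof.
(* The maximum with 1 keeps the reciprocal positive whatever the sign of [a]. *)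
have e0 : 0 < (Num.max 1 a)^-1 by rewrite invr_gt0 lt_max ltr01.
move/cvgrPdist_lt : h0 => /(_ _ e0); apply: filterS => n.
rewrite sub0r normrN gtr0_norm// => hn.
apply: (@le_trans _ _ (Num.max 1 a)); first by rewrite le_max lexx orbT.
by rewrite -[leLHS]invrK lef_pV2 ?posrE// ltW.
Qed.

Lemma summand_asymp b :
  (deconv_scale n)^-1 * expint mu l b (h n)^-1 - mu / l * cos ((h n)^-1 * b)
  @[n --> \oo] --> (0 : R).
Proof.
have [a [c [a0 ac]]] := expint_asymp mu0 l1 b.
apply/norm_cvg0P.
apply: (@squeeze_cvgr _ _ _ _ (cst 0) (fun n => c * (h n + h n `^ (l - 1)))).
- move: (V_gt a); apply: filterS => n an; rewrite normr_ge0/= deconv_scaleV.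
  have := ac _ an; rewrite invrK.
  by rewrite -[1 - l]opprB powRN powR_inv// invrK.
- exact: cvg_cst.
- rewrite -[X in _ --> X](mulr0 c); apply: cvgM; first exact: cvg_cst.
  by rewrite -[X in _ --> X]addr0; exact: cvgD.
Qed.

(** The amplitude of the limiting cosine; [kp ^+ 2 / 2] is the variance of the limit law. *)
Let kp := pi^-1 * (mu / l).
Let kp_ge0 : 0 <= kp.
Proof. by rewrite mulr_ge0 ?divr_ge0 ?invr_ge0 ?pi_ge0 ?ltW. Qed.

Let osc n y := kp * cos ((h n)^-1 * (y - x)).

Lemma deconv_summand_cvg y : deconv_summand n y - osc n y @[n --> \oo] --> (0 : R).
Proof.
have := summand_asymp (y - x).
move=> /(cvgM (cvg_cst pi^-1)); rewrite mulr0.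
apply: cvg_trans; apply: near_eq_cvg; near=> n.
rewrite /deconv_summand /osc /kp/=; ring.
Unshelve. all: by end_near. Qed.

(** At b = 0 the normalised integral tends to mu / l, so it is eventually at most mu / l + 1, and it
    dominates the integrals for all other [b]. *)
Lemma deconv_summand_bounded :
  \forall n \near \oo, forall y, `|deconv_summand n y| <= kp + pi^-1.
Proof.
have /cvgrPdist_le/(_ 1 ltr01) := summand_asymp 0.
apply: filterS => n; rewrite sub0r normrN mulr0 cos0 mulr1 => n1 y.
have s0 : 0 <= (deconv_scale n)^-1 by rewrite invr_ge0 ltW// deconv_scale_gt0.
have p0 : 0 <= pi^-1 :> R by rewrite invr_ge0 pi_ge0.
have -> : kp + pi^-1 = pi^-1 * (mu / l + 1) by rewrite mulrDr mulr1.
rewrite /deconv_summand mulrCA normrM (ger0_norm p0).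
rewrite ler_wpM2l// normrM (ger0_norm s0).
apply: (@le_trans _ _ ((deconv_scale n)^-1 * expint mu l 0 (h n)^-1)).
  by rewrite ler_wpM2l// expint_le.
by move: n1; rewrite ler_norml; lra.
Qed.

Lemma measurable_deconv_summand n : measurable_fun [set: R] (deconv_summand n).
Proof.
do 2 apply: measurable_funM => //.
apply: (measurableT_comp (f := fun b => expint mu l b (h n)^-1)).
  by apply: continuous_measurable_fun; exact: continuous_expint.
exact: measurable_funB.
Qed.

(** Here the bound may depend on [n], which makes the expectations meaningful for every [n] and not
    only eventually. *)
Lemma bounded_mfun_deconv_summand n : bounded_mfun (deconv_summand n).
Proof.
split; first exact: measurable_deconv_summand.
exists ((deconv_scale n)^-1 * (pi^-1 * expint mu l 0 (h n)^-1)) => y.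
have s0 : 0 <= (deconv_scale n)^-1 by rewrite invr_ge0 ltW// deconv_scale_gt0.
have p0 : 0 <= pi^-1 :> R by rewrite invr_ge0 pi_ge0.
rewrite /deconv_summand !normrM (ger0_norm s0) (ger0_norm p0).
by rewrite ler_wpM2l// ler_wpM2l// expint_le.
Qed.

(** The factor [c] is 1 for the mean and 2 for the variance. *)
Let cos_cvg c : 0 < c ->
  \int[P]_w cos (c * (h n)^-1 * (X w - x)) @[n --> \oo] --> (0 : R).
Proof.
move=> c0; apply/norm_cvg0P.
(* This [b] turns the exponential bound into exp (- h^(-l) / b), which is at most b h^l by exp u >=
   u, hence at most b h once h <= 1. *)
pose b := mu / c `^ l.
have b0 : 0 < b by rewrite divr_gt0// powR_gt0.
apply: (@squeeze_cvgr _ _ _ _ (cst 0) (fun n => b * h n)).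
- near=> n; rewrite normr_ge0/= (le_trans (cosX _))//.
  have hn := h_gt0 n; have hn0 : 0 < (h n)^-1 by rewrite invr_gt0.
  have hV1 : 1 <= (h n)^-1 by near: n; exact: V_gt.
  rewrite gtr0_norm ?mulr_gt0// powRM ?(ltW c0) ?(ltW hn0)//.
  rewrite -mulrA -[c `^ l]invrK.
  have -> : - ((c `^ l)^-1^-1 * ((h n)^-1 `^ l / mu)) = - ((h n)^-1 `^ l / b).
    by rewrite /b invf_div invrK; congr (- _); ring.
  rewrite expRN -[leRHS]invrK lef_pV2 ?posrE ?expR_gt0 ?invr_gt0 ?mulr_gt0
    ?invr_gt0 ?powR_gt0//.
  rewrite (le_trans _ (expR_ge1Dx _))// invfM.
  apply: (@le_trans _ _ ((h n)^-1 `^ l / b)); last by rewrite lerDr.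
  by rewrite mulrC ler_wpM2r ?invr_ge0 ?(ltW b0)// le1r_powR// ltW.
- exact: cvg_cst.
- by rewrite -[X in _ --> X](mulr0 b); apply: cvgM; first exact: cvg_cst.
Unshelve. all: by end_near. Qed.

Let rest n w := deconv_summand n (X w) - osc n (X w).

Let bounded_osc n : bounded_mfun (osc n).
Proof. by apply: bounded_mfunM; [exact: bounded_mfun_cst|exact: bounded_mfun_cos]. Qed.

Let norm_osc n y : `|osc n y| <= kp.
Proof.
rewrite normrM (ger0_norm kp_ge0) -[leRHS]mulr1 ler_wpM2l//.
by rewrite ler_norml cos_geN1 cos_le1.
Qed.

Let bounded_rest n : bounded_mfun (rest n).
Proof.
apply: (bounded_mfun_comp mX (f := fun y => deconv_summand n y - osc n y)).
by apply: bounded_mfunB => //; exact: bounded_mfun_deconv_summand.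
Qed.

(** The cosine approximation is only pointwise in the observation; the eventual uniform bound allows
    dominated convergence. *)
Let rest_cvg : \int[P]_w `|rest n w| @[n --> \oo] --> (0 : R).
Proof.
apply: (@bounded_dominated_cvg _ _ _ P _ (kp + pi^-1 + kp)).
- by move=> n; have [] := bounded_mfun_norm (bounded_rest n).
- move: deconv_summand_bounded; apply: filterS => n hn w; rewrite normr_id.
  by rewrite (le_trans (ler_normB _ _))// lerD.
- by move=> w; apply/norm_cvg0P; exact: deconv_summand_cvg.
Qed.

Lemma deconv_mean_cvg :
  \int[P]_w deconv_summand n (X w) @[n --> \oo] --> (0 : R).
Proof.
have E n : \int[P]_w deconv_summand n (X w) =
    \int[P]_w rest n w + kp * \int[P]_w cos (1 * (h n)^-1 * (X w - x)).
  rewrite -Rintegral_boundedZl; last first.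
    exact: (bounded_mfun_comp mX (bounded_mfun_cos _ _)).
  rewrite -Rintegral_boundedD//; last first.
    apply: bounded_mfunM; first exact: bounded_mfun_cst.
    exact: (bounded_mfun_comp mX (bounded_mfun_cos _ _)).
  by apply: eq_Rintegral => w _; rewrite /rest /osc mul1r subrK.
rewrite (funext E) -[X in _ --> X]addr0; apply: cvgD.
  apply/norm_cvg0P; apply: (@squeeze_cvgr _ _ _ _ (cst 0) _ _ _ _ (cvg_cst _) rest_cvg).
  near=> n; rewrite normr_ge0/=; exact: le_norm_Rintegral_bounded.
rewrite -[X in _ --> X](mulr0 kp); apply: cvgM; first exact: cvg_cst.
exact: cos_cvg.
Unshelve. all: by end_near. Qed.

Lemma deconv_variance_cvg :
  \int[P]_w (deconv_summand n (X w) - \int[P]_w deconv_summand n (X w)) ^+ 2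
  @[n --> \oo] --> kp ^+ 2 / 2.
Proof.
pose m n := \int[P]_w deconv_summand n (X w).
(* The difference of the squares of the summand and of its cosine, factored so that a bounded
   function multiplies [rest n]. *)
pose q n w := rest n w * (deconv_summand n (X w) + osc n (X w)).
have bX (f : R -> R) : bounded_mfun f -> bounded_mfun (fun w => f (X w)).
  exact: bounded_mfun_comp.
have bd n : bounded_mfun (fun w => deconv_summand n (X w)).
  exact/bX/bounded_mfun_deconv_summand.
have bq n : bounded_mfun (q n).
  by apply: bounded_mfunM => //; apply: bounded_mfunD => //; exact: bX.
have bc a : bounded_mfun (fun w => kp ^+ 2 / 2 * cos (a * (X w - x))).
  by apply: bounded_mfunM; [exact: bounded_mfun_cst|exact: (bX _ (bounded_mfun_cos a x))].
have bk (a : R) : bounded_mfun (fun _ : T => a) by exact: bounded_mfun_cst.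
have bm n : bounded_mfun (fun w => 2 * m n * deconv_summand n (X w)).
  by apply: bounded_mfunM.
(* The square of the summand is [q] plus that of [osc], and doubling the angle splits the latter
   into the constant kp^2 / 2 and a cosine at twice the frequency. *)
have E n : \int[P]_w (deconv_summand n (X w) - m n) ^+ 2 =
    \int[P]_w q n w + kp ^+ 2 / 2 +
    kp ^+ 2 / 2 * \int[P]_w cos (2 * (h n)^-1 * (X w - x)) - m n ^+ 2.
  transitivity (\int[P]_w (q n w + kp ^+ 2 / 2 +
      kp ^+ 2 / 2 * cos (2 * (h n)^-1 * (X w - x)) -
      2 * m n * deconv_summand n (X w) + m n ^+ 2)).
    apply: eq_Rintegral => w _.
    have -> : 2 * (h n)^-1 * (X w - x) = ((h n)^-1 * (X w - x)) *+ 2.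
      by rewrite -mulrA mulr_natl.
    rewrite cos_mulr2n /q /rest /osc.
    by move: (cos _) (deconv_summand _ _) (m n) kp => c z a p; field.
  rewrite Rintegral_boundedD//; last first.
    by apply: bounded_mfunB => //; apply: bounded_mfunD => //; exact: bounded_mfunD.
  rewrite Rintegral_boundedB//; last first.
    by apply: bounded_mfunD => //; exact: bounded_mfunD.
  rewrite Rintegral_boundedD//; last exact: bounded_mfunD.
  rewrite Rintegral_boundedD// !Rintegral_prob_cst.
  rewrite (Rintegral_boundedZl _ _ (bd n)) -/(m n).
  rewrite (Rintegral_boundedZl _ _ (bX _ (bounded_mfun_cos _ _))).
  by move: (\int[P]_w q n w) (\int[P]_w _) (m n) (kp ^+ 2 / 2) => *; ring.
rewrite (funext E).
have q0 : \int[P]_w q n w @[n --> \oo] --> (0 : R).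
  apply/norm_cvg0P.
  pose K := kp + pi^-1 + kp.
  apply: (@squeeze_cvgr _ _ _ _ (cst 0) (fun n => K * \int[P]_w `|rest n w|)).
  - move: deconv_summand_bounded; apply: filterS => n hn.
    rewrite normr_ge0/= -(Rintegral_boundedZl _ _ (bounded_mfun_norm (bounded_rest n))).
    apply: (le_trans (le_norm_Rintegral_bounded _ (bq n))).
    apply: le_Rintegral_bounded.
    + exact: bounded_mfun_norm.
    + by apply: bounded_mfunM => //; exact: bounded_mfun_norm.
    + move=> w; rewrite /q normrM mulrC ler_wpM2r// (le_trans (ler_normD _ _))//.
      by rewrite lerD.
  - exact: cvg_cst.
  - by rewrite -[X in _ --> X](mulr0 K); apply: cvgM; first exact: cvg_cst.
rewrite [X in _ --> X](_ : _ = 0 + kp ^+ 2 / 2 + kp ^+ 2 / 2 * 0 - 0 ^+ 2); last first.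
  by rewrite mulr0 expr0n/= subr0 addr0 add0r.
apply: cvgB; last first.
  rewrite expr2; under eq_fun do rewrite expr2.
  by apply: cvgM; exact: deconv_mean_cvg.
apply: cvgD; last by apply: cvgM; [exact: cvg_cst|exact: cos_cvg].
by apply: cvgD => //; exact: cvg_cst.
Qed.

End deconvolution_asymptotics.

(** * The limit theorem for the estimator *)

Theorem theorem2p1 (R : realType) (d : measure_display) (T : measurableType d)
    (P : probability T R) (mu lambda : R) (f k : R -> R)
    (Y Z : nat -> {RV P >-> R}) (h : nat -> R) (x : R) :
  let X : nat -> T -> R := fun j omega => Y j omega + Z j omega in
  let fnh : nat -> T -> R :=
    fun n => deconv_estimator phi_sinc (fourier k) X n (h n) x in
  0 < mu -> 1 < lambda <= 2 ->
  is_density k ->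
  (forall t, fourier k t = (expR (- (`|t| `^ lambda / mu)))%:C) ->
  iid P X ->
  (forall j, independent2 P (Y j) (Z j)) ->
  (forall j, has_density (Y j) f) ->
  (forall j, has_density (Z j) k) ->
  (forall n, 0 < h n) ->
  h n @[n --> \oo] --> (0 : R) ->
  cvg_in_distribution P
    (fun n omega =>
       Num.sqrt n%:R / (h n `^ (lambda - 1) * expR (1 / (mu * h n `^ lambda)))
       * (fnh n omega - fine 'E_P[fnh n]))
    (normal_prob 0 (Num.sqrt (1 / (2 * pi ^+ 2) * (mu / lambda) ^+ 2))).
Proof.
move=> X fnh mu0 /andP[l1 _] _ phik iidX YZ _ kZ h_gt0 h0.
have [mX _ idX] := iidX.
have cosX t : `|\int[P]_w cos (t * (X 0%N w - x))| <= expR (- (`|t| `^ lambda / mu)).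
  by apply: (cos_expectation_le x (YZ 0%N) (kZ 0%N) (phik t)); exact: expR_ge0.
pose sc := deconv_scale mu lambda h.
pose zeta := deconv_summand mu lambda x h.
pose m n := \int[P]_w zeta n (X 0%N w).
pose z n y := zeta n y - m n.
pose sg := Num.sqrt (1 / (2 * pi ^+ 2) * (mu / lambda) ^+ 2).
have pi0 : 0 < pi :> R by exact: pi_gt0.
have l0 : 0 < lambda by exact: lt_trans l1.
have sg2 : 0 < 1 / (2 * pi ^+ 2) * (mu / lambda) ^+ 2.
  apply: mulr_gt0; last by rewrite exprn_gt0// divr_gt0.
  by rewrite divr_gt0// mulr_gt0// exprn_gt0.
have sg0 : 0 < sg by rewrite sqrtr_gt0.
have bzeta n : bounded_mfun (zeta n) by exact: bounded_mfun_deconv_summand.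
have bz n : bounded_mfun (z n).
  by apply: bounded_mfunB => //; exact: bounded_mfun_cst.
have bX j (u : R -> R) : bounded_mfun u -> bounded_mfun (fun w => u (X j w)).
  exact: (bounded_mfun_comp (mX j)).
have zetaC := deconv_summand_bounded x mu0 l1 h_gt0 h0.
(* Centring at most doubles the uniform bound on [zeta]. *)
have zC : \forall n \near \oo, forall y, `|z n y| <= 2 * (pi^-1 * (mu / lambda) + pi^-1).
  move: zetaC; apply: filterS => n hn y.
  rewrite (le_trans (ler_normB _ _))// mulr_natl mulr2n lerD//.
  by apply: norm_Rintegral_le => [|w]; [exact: bX|exact: hn].
have Ez n : \int[P]_w z n (X 0%N w) = 0.
  rewrite Rintegral_boundedB ?Rintegral_prob_cst ?subrr//.
  - exact: bX.
  - exact: bounded_mfun_cst.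
have Ev : \int[P]_w (z n (X 0%N w) ^+ 2) @[n --> \oo] --> sg ^+ 2.
  have -> : sg ^+ 2 = (pi^-1 * (mu / lambda)) ^+ 2 / 2.
    rewrite sqr_sqrtr ?(ltW sg2)//.
    move: (@pi R) pi0 => p p0.
    by field; rewrite (gt_eqF p0) (gt_eqF l0).
  exact: (deconv_variance_cvg mu0 l1 (mX 0%N) cosX h_gt0 h0).
(* An exact identity: the estimator averages [g (X j)], and [g] is [sc n] times [zeta n], so the
   normalised statistic is the row sum of the centred summands. *)
have WE n w : Num.sqrt n%:R / (h n `^ (lambda - 1) *
    expR (1 / (mu * h n `^ lambda))) * (fnh n w - fine 'E_P[fnh n]) =
    (Num.sqrt n%:R)^-1 * \sum_(j < n) z n (X j w).
  pose g y := pi^-1 * expint mu lambda (y - x) (h n)^-1.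
  have gE y : zeta n y = (sc n)^-1 * g y by [].
  have sc0 : sc n != 0 by rewrite gt_eqF// deconv_scale_gt0.
  have gE' y : g y = sc n * zeta n y by rewrite gE mulrA divff// mul1r.
  have bg : bounded_mfun g.
    have -> : g = (fun y => sc n * zeta n y) by apply/funext.
    by apply: bounded_mfunM => //; exact: bounded_mfun_cst.
  have fE : fnh n = (fun w => n%:R^-1 * \sum_(j < n) g (X j w)).
    by apply/funext => u; rewrite /fnh (deconv_estimatorE mu0 l1 phik).
  have bs : bounded_mfun (fun w => \sum_(j < n) g (X j w)).
    by apply: (bounded_mfun_sum n (f := fun j w => g (X j w))) => j; exact: bX.
  have -> : fine 'E_P[fnh n] = n%:R^-1 * \sum_(j < n) (sc n * m n).
    rewrite fE expectation_bounded/=; last first.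
      by apply: bounded_mfunM => //; exact: bounded_mfun_cst.
    rewrite Rintegral_boundedZl//; apply: (congr1 ( *%R _)).
    rewrite (@Rintegral_sum_ord _ _ _ P _ (fun j w => g (X j w)))//; last first.
      by move=> j; apply: bounded_integrable; exact: bX.
    apply: eq_bigr => j _.
    rewrite (identically_distributed_Rintegral mX idX j 0%N bg).
    under eq_Rintegral do rewrite gE'.
    by rewrite Rintegral_boundedZl//; exact: bX.
  rewrite fE -mulrBr -sumrB.
  have -> : \sum_(j < n) (g (X j w) - sc n * m n) =
      sc n * \sum_(j < n) z n (X j w).
    by rewrite mulr_sumr; apply: eq_bigr => j _; rewrite gE' /z mulrBr.
  (* This also holds at n = 0, where the inverse of 0 is 0. *)
  have -> : (Num.sqrt n%:R)^-1 = Num.sqrt n%:R * n%:R^-1 :> R.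
    have [->|n0] := posnP n; first by rewrite invr0 mulr0 sqrtr0 invr0.
    rewrite -[in X in _ = _ * X](@sqr_sqrtr _ (n%:R : R)) ?ler0n//.
    by field; rewrite gt_eqF// sqrtr_gt0 ltr0n.
  rewrite -/(deconv_scale mu lambda h n) -/(sc n).
  move: (\sum_(_ < _) _) => S; move: sc0; move: (sc n) (Num.sqrt _) (n%:R^-1).
  by move=> s q r s0; field.
have mW n : measurable_fun [set: T] (fun w => (Num.sqrt n%:R)^-1 *
    \sum_(j < n) z n (X j w)).
  apply: measurable_funM => //; apply: measurable_sum => j.
  by apply: measurableT_comp => //; have [] := bz n.
split=> [n|a _]; first by rewrite (funext (WE n)).
rewrite [X in _ --> X](_ : _ = (stdnormal_cdf (a / sg))%:E); last first.
  exact: normal_prob_itvNy.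
apply: cvg_EFin.
  apply: nearW => n; apply: fin_num_measure; rewrite (funext (WE n)).
  by rewrite -[X in measurable X]setTI; exact: mW.
have -> : fine \o (fun n => P ((fun w => Num.sqrt n%:R / (h n `^ (lambda - 1) *
    expR (1 / (mu * h n `^ lambda))) * (fnh n w - fine 'E_P[fnh n])) @^-1`
    `]-oo, a])) = (fun n => fine (P ((fun w => (Num.sqrt n%:R)^-1 *
    \sum_(j < n) z n (X j w)) @^-1` `]-oo, a]))).
  by apply/funext => n /=; rewrite (funext (WE n)).
exact: (@bounded_array_clt _ _ _ _ _ iidX _ _ _ (fun n => proj1 (bz n)) zC Ez sg0 Ev a).
Qed.
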